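(* Let $\mathbb{F}_2=\{([x:y:z],[u:v])\in\mathbb{P}^2\times\mathbb{P}^1 \mid yv^2=zu^2\}$ be the second Hirzebruch surface over $\mathbb{C}$, let $G=\operatorname{Aut}(\mathbb{F}_2)$ be its automorphism group with its tautological action on $\mathbb{F}_2$, and let $\widehat{\pi}:\widehat{\mathcal{W}}\to\operatorname{Specf}(\mathbb{C}[[t]])$ be the formal semi-universal deformation of $\mathbb{F}_2$ described in the context, given by the sequence of infinitesimal deformations $\pi_n:\mathcal{W}_n\to\operatorname{Spec}(\mathbb{C}[t]/(t^{n+1}))$, $n\ge 0$, with closed embeddings $f_n:\mathbb{F}_2\to\mathcal{W}_n$. Then the action of $G$ on $\mathbb{F}_2$ does not extend to $\widehat{\mathcal{W}}$. That is, there do not exist algebraic $G$-actions on $\mathcal{W}_n$ and on $\operatorname{Spec}(\mathbb{C}[t]/(t^{n+1}))$ for all $n\ge 0$ such that (i) for every $n$, the morphism $\pi_n$ and the embedding $f_n:\mathbb{F}_2\to\mathcal{W}_n$ are $G$-equivariant (where $\mathbb{F}_2$ carries the tautological $G$-action), and (ii) for every $n\ge 1$, the $G$-actions at level $n$ induce those at level $n-1$ by pullback along the natural closed immersion $\operatorname{Spec}(\mathbb{C}[t]/(t^{n}))\to\operatorname{Spec}(\mathbb{C}[t]/(t^{n+1}))$.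
   Context: Everything is over $\mathbb{C}$. The group $G=\operatorname{Aut}(\mathbb{F}_2)$ is a $7$-dimensional linear algebraic group. Its elements are exactly the maps, for $f$ a binary quadratic form $f(u,v)=a_0v^2+a_1uv+a_2u^2$ and $M=\begin{pmatrix} a&b\\c&d\end{pmatrix}\in \mathrm{GL}(2,\mathbb{C})$, sending $([x:y:z],[u:v])$ to $([xu^2+yf(u,v):y(au+bv)^2:y(cu+dv)^2],[au+bv:cu+dv])$ if $u\neq 0$ and to $([xv^2+zf(u,v):z(au+bv)^2:z(cu+dv)^2],[au+bv:cu+dv])$ if $v\ne 0$; the pair $(f,M)$ is determined up to replacing $M$ by $-M$. As an algebraic group $G$ is the quotient of $\mathbb{C}^3\rtimes \mathrm{GL}(2,\mathbb{C})$ by $\{\pm I\}$, where $\mathbb{C}^3$ is the space of binary quadratic forms with $\mathrm{GL}(2,\mathbb{C})$ acting by linear substitution. The family $\mathcal{W}$: let $W=\mathbb{C}\times\mathbb{C}\times\mathbb{P}^1$ with coordinates $(t,v,[x:y])$ and $W'=\mathbb{C}\times\mathbb{C}\times\mathbb{P}^1$ with coordinates $(t',v',[x':y'])$. The scheme $\mathcal{W}$ is obtained by gluing $W$ and $W'$ along the open subsets $\{v\ne0\}$ and $\{v'\neq 0\}$ via $$vv'=1,\quad x'=x,\quad y'=yv^2-tvx,\quad t'=t,$$ and $\pi:\mathcal{W}\to\mathbb{C}=\operatorname{Spec}(\mathbb{C}[t])$ is induced by the projections to the first coordinate. The fiber $\pi^{-1}(0)$ is identified with $\mathbb{F}_2$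 via $(v,[x:y])\mapsto([x:y:yv^2],[1:v])$ and $(v',[x':y'])\mapsto([x':y'v'^2:y'],[v':1])$. The formal deformation $\widehat{\pi}:\widehat{\mathcal{W}}\to\operatorname{Specf}(\mathbb{C}[[t]])$ associated to $\pi$ is the sequence of pullbacks $\pi_n:\mathcal{W}_n=\mathcal{W}\times_{\operatorname{Spec}\mathbb{C}[t]}\operatorname{Spec}(\mathbb{C}[t]/(t^{n+1}))\to\operatorname{Spec}(\mathbb{C}[t]/(t^{n+1}))$, with $f_n:\mathbb{F}_2\cong\pi^{-1}(0)\to\mathcal{W}_n$ the inclusion of the central fiber; $\widehat{\mathcal W}$ is the ringed space $(\mathbb{F}_2,\varprojlim\mathcal{O}_{\mathcal{W}_n})$. It is a formal semi-universal deformation of $\mathbb{F}_2$. An algebraic action of $G$ on a scheme $Y$ over $\mathbb{C}$ is an action given by a morphism of $\mathbb{C}$-schemes $G\times Y\to Y$. The action of $G$ on the base $\operatorname{Spec}(\mathbb{C}[t]/(t^{n+1}))$ is allowed to be nontrivial. *)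

(* Defs.v *)
(* The definitions are over a field k, which is meant to be the field [R[i]] of
   complex numbers, for [R : realType]. *)
From HB Require Import structures.
From mathcomp Require Import all_boot all_algebra.
From mathcomp Require Import all_classical all_reals.
From mathcomp Require Export complex.

Set Implicit Arguments.
Unset Strict Implicit.
Unset Printing Implicit Defensive.

Import GRing.Theory.
Local Open Scope ring_scope.
Local Open Scope classical_set_scope.

(* Schemes over k are given by their functors of points, and morphisms of
   k-schemes are natural transformations (Yoneda).  The test objects are the
   nonzero commutative k-algebras; the zero algebra carries no information, as
   every scheme has exactly one point with values in it. *)

Record kfunctor (k : fieldType) := KFunctor {
  pts :> comAlgType k -> Type;
  base_change : forall A B : comAlgType k, {lrmorphism A -> B} -> pts A -> pts B;
  base_change_id : forall (A : comAlgType k) (x : pts A),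
    base_change (idfun : {lrmorphism A -> A}) x = x;
  base_change_comp : forall (A B D : comAlgType k)
    (phi : {lrmorphism A -> B}) (psi : {lrmorphism B -> D}) (x : pts A),
    base_change (psi \o phi : {lrmorphism A -> D}) x
    = base_change psi (base_change phi x) }.

Record group_functor (k : fieldType) := GroupFunctor {
  gpts :> kfunctor k;
  gone : forall A : comAlgType k, gpts A;
  gmul : forall A : comAlgType k, gpts A -> gpts A -> gpts A;
  gone_nat : forall (A B : comAlgType k) (phi : {lrmorphism A -> B}),
    base_change phi (gone A) = gone B;
  gmul_nat : forall (A B : comAlgType k) (phi : {lrmorphism A -> B})
    (g h : gpts A),
    base_change phi (gmul g h) = gmul (base_change phi g) (base_change phi h);
  gmulA : forall (A : comAlgType k) (g h i : gpts A),
    gmul g (gmul h i) = gmul (gmul g h) i;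
  gmul1l : forall (A : comAlgType k) (g : gpts A), gmul (gone A) g = g;
  gmul1r : forall (A : comAlgType k) (g : gpts A), gmul g (gone A) = g;
  gmulV : forall (A : comAlgType k) (g : gpts A),
    exists h : gpts A, gmul h g = gone A /\ gmul g h = gone A }.

(* An action given by a morphism [G x Y -> Y]. *)
Record algebraic_action (k : fieldType) (G : group_functor k) (Y : kfunctor k) :=
  AlgebraicAction {
  act :> forall A : comAlgType k, G A -> Y A -> Y A;
  act_nat : forall (A B : comAlgType k) (phi : {lrmorphism A -> B})
    (g : G A) (y : Y A),
    base_change phi (act g y) = act (base_change phi g) (base_change phi y);
  act1 : forall (A : comAlgType k) (y : Y A), act (gone G A) y = y;
  actM : forall (A : comAlgType k) (g h : G A) (y : Y A),
    act (gmul g h) y = act g (act h y) }.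

Lemma lrmorphism_eq (k : fieldType) (A B : comAlgType k)
    (f g : {lrmorphism A -> B}) : (f : A -> B) = g -> f = g.
Proof.
case: f g => [f [[a] [b] [c]]] [g [[a'] [b'] [c']]] /= efg; subst g.
by rewrite (Prop_irrelevance a a') (Prop_irrelevance b b')
           (Prop_irrelevance c c').
Qed.

Lemma sig_eq (T : Type) (P : T -> Prop) (x y : {z : T | P z}) :
  proj1_sig x = proj1_sig y -> x = y.
Proof.
case: x y => [x Px] [y Py] /= exy; subst y.
by rewrite (Prop_irrelevance Px Py).
Qed.

(* The automorphism group functor: the A-points of [Aut Y] are the
   automorphisms of [Y x Spec A] over [Spec A], i.e. the natural automorphisms
   of the restriction of [Y] to A-algebras.  For Y projective this is the
   functor of points of the automorphism group scheme of Y. *)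

Definition aut_family (k : fieldType) (Y : kfunctor k) (A : comAlgType k) :=
  forall B : comAlgType k, {lrmorphism A -> B} -> Y B -> Y B.

Definition aut_natural (k : fieldType) (Y : kfunctor k) (A : comAlgType k)
    (g : aut_family Y A) : Prop :=
  forall (B D : comAlgType k) (phi : {lrmorphism A -> B})
    (psi : {lrmorphism B -> D}) (y : Y B),
    base_change psi (g B phi y)
    = g D (psi \o phi : {lrmorphism A -> D}) (base_change psi y).

Definition is_aut (k : fieldType) (Y : kfunctor k) (A : comAlgType k)
    (g : aut_family Y A) : Prop :=
  aut_natural g /\
  exists h : aut_family Y A, aut_natural h /\
    forall (B : comAlgType k) (phi : {lrmorphism A -> B}),
      cancel (g B phi) (h B phi) /\ cancel (h B phi) (g B phi).

Definition aut_pts (k : fieldType) (Y : kfunctor k) (A : comAlgType k) : Type :=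
  {g : aut_family Y A | is_aut g}.

Definition aut_family_bc (k : fieldType) (Y : kfunctor k) (A B : comAlgType k)
    (phi : {lrmorphism A -> B}) (g : aut_family Y A) : aut_family Y B :=
  fun D psi => g D (psi \o phi : {lrmorphism A -> D}).

Lemma aut_natural_bc (k : fieldType) (Y : kfunctor k) (A B : comAlgType k)
    (phi : {lrmorphism A -> B}) (g : aut_family Y A) :
  aut_natural g -> aut_natural (aut_family_bc phi g).
Proof.
move=> gn D E psi chi y; rewrite /aut_family_bc gn.
by congr (g E _ _); exact: lrmorphism_eq.
Qed.

Lemma is_aut_bc (k : fieldType) (Y : kfunctor k) (A B : comAlgType k)
    (phi : {lrmorphism A -> B}) (g : aut_family Y A) :
  is_aut g -> is_aut (aut_family_bc phi g).
Proof.
move=> [gn [h [hn gh]]]; split; first exact: aut_natural_bc.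
exists (aut_family_bc phi h); split; first exact: aut_natural_bc.
by move=> D psi; exact: gh.
Qed.

Definition aut_bc (k : fieldType) (Y : kfunctor k) (A B : comAlgType k)
    (phi : {lrmorphism A -> B}) (g : aut_pts Y A) : aut_pts Y B :=
  exist _ (aut_family_bc phi (proj1_sig g)) (is_aut_bc phi (proj2_sig g)).

Lemma aut_family_eq (k : fieldType) (Y : kfunctor k) (A : comAlgType k)
    (g h : aut_family Y A) :
  (forall B phi y, g B phi y = h B phi y) -> g = h.
Proof.
move=> gh; apply: functional_extensionality_dep => B.
by apply/funext => phi; apply/funext => y; exact: gh.
Qed.

Lemma aut_bc_id (k : fieldType) (Y : kfunctor k) (A : comAlgType k)
    (g : aut_pts Y A) : aut_bc (idfun : {lrmorphism A -> A}) g = g.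
Proof.
apply: sig_eq; apply: aut_family_eq => B phi y /=.
by congr (proj1_sig g B _ y); exact: lrmorphism_eq.
Qed.

Lemma aut_bc_comp (k : fieldType) (Y : kfunctor k) (A B D : comAlgType k)
    (phi : {lrmorphism A -> B}) (psi : {lrmorphism B -> D}) (g : aut_pts Y A) :
  aut_bc (psi \o phi : {lrmorphism A -> D}) g = aut_bc psi (aut_bc phi g).
Proof.
apply: sig_eq; apply: aut_family_eq => E chi y /=.
by congr (proj1_sig g E _ y); exact: lrmorphism_eq.
Qed.

Definition Aut_functor (k : fieldType) (Y : kfunctor k) : kfunctor k :=
  KFunctor (@aut_bc_id k Y) (@aut_bc_comp k Y).

Lemma is_aut_one (k : fieldType) (Y : kfunctor k) (A : comAlgType k) :
  is_aut ((fun B phi y => y) : aut_family Y A).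
Proof. by split=> //; exists (fun B phi y => y). Qed.

Lemma is_aut_mul (k : fieldType) (Y : kfunctor k) (A : comAlgType k)
    (g h : aut_family Y A) :
  is_aut g -> is_aut h -> is_aut (fun B phi y => g B phi (h B phi y)).
Proof.
move=> [gn [g' [gn' gg']]] [hn [h' [hn' hh']]]; split.
  by move=> B D phi psi y; rewrite gn hn.
exists (fun B phi y => h' B phi (g' B phi y)); split.
  by move=> B D phi psi y; rewrite hn' gn'.
move=> B phi; have [g1 g2] := gg' B phi; have [h1 h2] := hh' B phi.
by split=> y; rewrite ?g1 ?h1 ?h2 ?g2.
Qed.

Definition aut_one (k : fieldType) (Y : kfunctor k) (A : comAlgType k) :
  Aut_functor Y A := exist _ _ (is_aut_one Y A).

Definition aut_mul (k : fieldType) (Y : kfunctor k) (A : comAlgType k)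
    (g h : Aut_functor Y A) : Aut_functor Y A :=
  exist _ _ (is_aut_mul (proj2_sig g) (proj2_sig h)).

Lemma aut_one_nat (k : fieldType) (Y : kfunctor k) (A B : comAlgType k)
    (phi : {lrmorphism A -> B}) : base_change phi (aut_one Y A) = aut_one Y B.
Proof. exact: sig_eq. Qed.

Lemma aut_mul_nat (k : fieldType) (Y : kfunctor k) (A B : comAlgType k)
    (phi : {lrmorphism A -> B}) (g h : Aut_functor Y A) :
  base_change phi (aut_mul g h)
  = aut_mul (base_change phi g) (base_change phi h).
Proof. exact: sig_eq. Qed.

Lemma aut_mulA (k : fieldType) (Y : kfunctor k) (A : comAlgType k)
    (g h i : Aut_functor Y A) :
  aut_mul g (aut_mul h i) = aut_mul (aut_mul g h) i.
Proof. exact: sig_eq. Qed.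

Lemma aut_mul1l (k : fieldType) (Y : kfunctor k) (A : comAlgType k)
    (g : Aut_functor Y A) : aut_mul (aut_one Y A) g = g.
Proof. exact: sig_eq. Qed.

Lemma aut_mul1r (k : fieldType) (Y : kfunctor k) (A : comAlgType k)
    (g : Aut_functor Y A) : aut_mul g (aut_one Y A) = g.
Proof. exact: sig_eq. Qed.

Lemma aut_mulV (k : fieldType) (Y : kfunctor k) (A : comAlgType k)
    (g : Aut_functor Y A) :
  exists h : Aut_functor Y A,
    aut_mul h g = aut_one Y A /\ aut_mul g h = aut_one Y A.
Proof.
case: g => g [gn [h [hn gh]]].
have hP : is_aut h.
  by split=> //; exists g; split=> // B phi; have [] := gh B phi.
exists (exist _ h hP); split; apply: sig_eq; apply: aut_family_eq => B phi y /=.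
  exact: (gh B phi).1.
exact: (gh B phi).2.
Qed.

Definition Aut (k : fieldType) (Y : kfunctor k) : group_functor k :=
  GroupFunctor (@aut_one_nat k Y) (@aut_mul_nat k Y) (@aut_mulA k Y)
    (@aut_mul1l k Y) (@aut_mul1r k Y) (@aut_mulV k Y).

Lemma taut_nat (k : fieldType) (Y : kfunctor k) (A B : comAlgType k)
    (phi : {lrmorphism A -> B}) (g : Aut Y A) (y : Y A) :
  base_change phi (proj1_sig g A (idfun : {lrmorphism A -> A}) y)
  = proj1_sig (base_change phi g) B (idfun : {lrmorphism B -> B})
      (base_change phi y).
Proof.
case: g => g [gn gI] /=; rewrite gn /aut_family_bc.
by congr (g B _ _); exact: lrmorphism_eq.
Qed.

(* The tautological action of [Aut Y] on [Y], by evaluation. *)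
Definition tautological_action (k : fieldType) (Y : kfunctor k) :
    algebraic_action (Aut Y) Y :=
  @AlgebraicAction k (Aut Y) Y
    (fun A g y => proj1_sig g A (idfun : {lrmorphism A -> A}) y)
    (@taut_nat k Y) (fun A y => erefl) (fun A g h y => erefl).

(* Gluing.  Let X be described by coordinates: a relation [same] says when two
   tuples of coordinates in an algebra B are admissible and describe the same
   B-point.  The A-points of the scheme X obtained by gluing are the sections
   over Spec A of the Zariski sheaf associated with the functor
   (tuples of coordinates modulo [same]).  Such a section is given by its germs,
   one for each local A-algebra B (in particular for each local ring of Spec A);
   a germ is an equivalence class of tuples with entries in B; and there must
   be a cover of Spec A by principal open sets Spec A[1/f] such that on each of
   them the germs all come from one tuple with entries in A[1/f].
   For the coordinates used below a germ is exactly a B-point of X, as a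
   morphism from the spectrum of a local ring factors through an affine chart,
   and a line bundle on such a spectrum is trivial. *)

Definition invertible (B : pzRingType) (a : B) : Prop := exists b : B, a * b = 1.

Definition local_alg (k : fieldType) (B : comAlgType k) : Prop :=
  forall a : B, invertible a \/ invertible (1 - a).

Record coordinates := Coordinates {
  ctuple :> Type -> Type;
  cmap : forall B D : Type, (B -> D) -> ctuple B -> ctuple D }.

Definition germs (k : fieldType) (c : coordinates) (A : comAlgType k) : Type :=
  forall B : comAlgType k, local_alg B -> {lrmorphism A -> B} -> set (c B).

(* A tuple with entries in A[1/f] is written [p / f ^ m]; in an A-algebra where
   f has the inverse b its entries become those of [p] times [b ^+ m]. *)
Definition frac_tuple (k : fieldType) (c : coordinates) (A B : comAlgType k)
    (phi : {lrmorphism A -> B}) (b : B) (m : nat) (p : c A) : c B :=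
  cmap (fun a => phi a * b ^+ m) p.

Definition glued_point (k : fieldType) (c : coordinates) (A : comAlgType k)
    (same : forall B : comAlgType k, {lrmorphism A -> B} -> c B -> c B -> Prop)
    (x : germs c A) : Prop :=
  exists (r : nat) (f e : 'I_r -> A),
    \sum_(i < r) e i * f i = 1 /\
    forall i : 'I_r, exists (p : c A) (m : nat),
      forall (B : comAlgType k) (locB : local_alg B)
        (phi : {lrmorphism A -> B}) (b : B), phi (f i) * b = 1 ->
        same B phi (frac_tuple phi b m p) (frac_tuple phi b m p) /\
        x B locB phi = [set q | same B phi (frac_tuple phi b m p) q].

Definition germs_bc (k : fieldType) (c : coordinates) (A A' : comAlgType k)
    (rho : {lrmorphism A -> A'}) (x : germs c A) : germs c A' :=
  fun B locB phi => x B locB (phi \o rho : {lrmorphism A -> B}).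

Lemma germs_eq (k : fieldType) (c : coordinates) (A : comAlgType k)
    (x y : germs c A) : (forall B locB phi, x B locB phi = y B locB phi) -> x = y.
Proof.
move=> xy; apply: functional_extensionality_dep => B.
apply: functional_extensionality_dep => locB.
by apply/funext => phi; exact: xy.
Qed.

Lemma germs_bc_id (k : fieldType) (c : coordinates) (A : comAlgType k)
    (x : germs c A) : germs_bc (idfun : {lrmorphism A -> A}) x = x.
Proof.
apply: germs_eq => B locB phi.
by congr (x B locB _); exact: lrmorphism_eq.
Qed.

Lemma germs_bc_comp (k : fieldType) (c : coordinates) (A B D : comAlgType k)
    (phi : {lrmorphism A -> B}) (psi : {lrmorphism B -> D}) (x : germs c A) :
  germs_bc (psi \o phi : {lrmorphism A -> D}) x = germs_bc psi (germs_bc phi x).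
Proof.
apply: germs_eq => E locE chi.
by congr (x E locE _); exact: lrmorphism_eq.
Qed.

Lemma glued_point_bc (k : fieldType) (c : coordinates)
    (cmap_comp : forall (A B D : Type) (f : A -> B) (g : B -> D) (p : c A),
       cmap g (cmap f p) = cmap (fun a => g (f a)) p)
    (A A' : comAlgType k) (rho : {lrmorphism A -> A'})
    (same : forall B : comAlgType k, {lrmorphism A -> B} -> c B -> c B -> Prop)
    (x : germs c A) :
  glued_point same x ->
  glued_point (fun B phi => same B (phi \o rho : {lrmorphism A -> B}))
    (germs_bc rho x).
Proof.
move=> [r [f [e [ef1 H]]]].
exists r, (fun i => rho (f i)), (fun i => rho (e i)); split.
  rewrite -(rmorph1 rho) -ef1 rmorph_sum; apply: eq_bigr => i _.
  by rewrite rmorphM.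
move=> i; have [p [m Hp]] := H i; exists (cmap rho p), m => B locB phi b fb1.
have -> : frac_tuple phi b m (cmap rho p)
          = frac_tuple (phi \o rho : {lrmorphism A -> B}) b m p.
  by rewrite /frac_tuple cmap_comp.
exact: Hp.
Qed.

(* [proj_eq s s']: s and s' are homogeneous coordinates of the same point of
   projective space over a local ring. *)
Definition unimodular (B : pzRingType) (s : seq B) : Prop :=
  exists w : seq B, \sum_(ab <- zip w s) ab.1 * ab.2 = 1.

Definition proj_eq (B : pzRingType) (s s' : seq B) : Prop :=
  unimodular s /\ exists l : B, invertible l /\ s' = [seq l * a | a <- s].

(* The surface F_2: the point ([x:y:z],[u:v]). *)
Inductive F2_tuple (B : Type) : Type := F2_at (x y z u v : B).

Definition F2_cmap (B D : Type) (f : B -> D) (p : F2_tuple B) : F2_tuple D :=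
  let: F2_at x y z u v := p in F2_at (f x) (f y) (f z) (f u) (f v).

Definition F2_coord : coordinates := Coordinates F2_cmap.

Definition F2_same (B : comPzRingType) (p q : F2_coord B) : Prop :=
  let: F2_at x y z u v := p in
  let: F2_at x' y' z' u' v' := q in
  [/\ y * v ^+ 2 = z * u ^+ 2,
      proj_eq [:: x; y; z] [:: x'; y'; z'] & proj_eq [:: u; v] [:: u'; v']].

Definition F2_pts (k : fieldType) (A : comAlgType k) : Type :=
  {x : germs F2_coord A | glued_point (fun B phi => @F2_same B) x}.

Lemma F2_cmap_comp (A B D : Type) (f : A -> B) (g : B -> D) (p : F2_coord A) :
  cmap g (cmap f p) = cmap (fun a => g (f a)) p.
Proof. by case: p. Qed.

Definition F2_bc (k : fieldType) (A A' : comAlgType k)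
    (rho : {lrmorphism A -> A'}) (x : F2_pts A) : F2_pts A' :=
  exist _ (germs_bc rho (proj1_sig x))
    (glued_point_bc F2_cmap_comp rho (proj2_sig x)).

Lemma F2_bc_id (k : fieldType) (A : comAlgType k) (x : F2_pts A) :
  F2_bc (idfun : {lrmorphism A -> A}) x = x.
Proof. by apply: sig_eq; exact: germs_bc_id. Qed.

Lemma F2_bc_comp (k : fieldType) (A B D : comAlgType k)
    (phi : {lrmorphism A -> B}) (psi : {lrmorphism B -> D}) (x : F2_pts A) :
  F2_bc (psi \o phi : {lrmorphism A -> D}) x = F2_bc psi (F2_bc phi x).
Proof. by apply: sig_eq; exact: germs_bc_comp. Qed.

Definition F2 (k : fieldType) : kfunctor k :=
  KFunctor (@F2_bc_id k) (@F2_bc_comp k).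

(* The family W.  [W_at v x y] is the point (t,v,[x:y]) of the first chart W,
   [W'_at v' x' y'] the point (t',v',[x':y']) of the second chart W'.  As the
   gluing has t' = t, the coordinate t is a global function: a point of the
   family is a pair of t and a point glued from the remaining coordinates. *)
Inductive W_tuple (B : Type) : Type := W_at (v x y : B) | W'_at (v' x' y' : B).

Definition W_cmap (B D : Type) (f : B -> D) (p : W_tuple B) : W_tuple D :=
  match p with
  | W_at v x y => W_at (f v) (f x) (f y)
  | W'_at v' x' y' => W'_at (f v') (f x') (f y')
  end.

Definition W_coord : coordinates := Coordinates W_cmap.

Definition W_overlap (B : comPzRingType) (t v x y v' x' y' : B) : Prop :=
  v * v' = 1 /\ proj_eq [:: x; y * v ^+ 2 - t * v * x] [:: x'; y'].

Definition W_same (B : comPzRingType) (t : B) (p q : W_coord B) : Prop :=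
  match p, q with
  | W_at v x y, W_at v1 x1 y1 => v1 = v /\ proj_eq [:: x; y] [:: x1; y1]
  | W'_at v x y, W'_at v1 x1 y1 => v1 = v /\ proj_eq [:: x; y] [:: x1; y1]
  | W_at v x y, W'_at v' x' y' => W_overlap t v x y v' x' y'
  | W'_at v' x' y', W_at v x y => W_overlap t v x y v' x' y'
  end.

Definition W_pts (k : fieldType) (A : comAlgType k) : Type :=
  {w : A * germs W_coord A |
    glued_point (fun B (phi : {lrmorphism A -> B}) => W_same (phi w.1)) w.2}.

Lemma W_cmap_comp (A B D : Type) (f : A -> B) (g : B -> D) (p : W_coord A) :
  cmap g (cmap f p) = cmap (fun a => g (f a)) p.
Proof. by case: p. Qed.

Definition W_bc (k : fieldType) (A A' : comAlgType k)
    (rho : {lrmorphism A -> A'}) (w : W_pts A) : W_pts A' :=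
  exist (fun w : A' * germs W_coord A' =>
      glued_point (fun B (phi : {lrmorphism A' -> B}) => W_same (phi w.1)) w.2)
    (rho (proj1_sig w).1, germs_bc rho (proj1_sig w).2)
    (glued_point_bc W_cmap_comp rho (proj2_sig w)).

Lemma W_bc_id (k : fieldType) (A : comAlgType k) (w : W_pts A) :
  W_bc (idfun : {lrmorphism A -> A}) w = w.
Proof. by apply: sig_eq; case: w => -[t w] wP; rewrite /= germs_bc_id. Qed.

Lemma W_bc_comp (k : fieldType) (A B D : comAlgType k)
    (phi : {lrmorphism A -> B}) (psi : {lrmorphism B -> D}) (w : W_pts A) :
  W_bc (psi \o phi : {lrmorphism A -> D}) w = W_bc psi (W_bc phi w).
Proof. by apply: sig_eq; rewrite /= germs_bc_comp. Qed.

Definition W (k : fieldType) : kfunctor k :=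
  KFunctor (@W_bc_id k) (@W_bc_comp k).

(* The projection pi : W -> Spec k[t]. *)
Definition W_pi (k : fieldType) (A : comAlgType k) (w : W k A) : A :=
  (proj1_sig w).1.

(* Spec (k[t]/(t^(n+1))). *)
Definition base_pts (k : fieldType) (n : nat) (A : comAlgType k) : Type :=
  {t : A | t ^+ n.+1 = 0}.

Lemma base_bcP (k : fieldType) (n : nat) (A B : comAlgType k)
    (phi : {lrmorphism A -> B}) (t : A) :
  t ^+ n.+1 = 0 -> phi t ^+ n.+1 = 0.
Proof. by move=> tn; rewrite -rmorphXn tn rmorph0. Qed.

Definition base_bc (k : fieldType) (n : nat) (A B : comAlgType k)
    (phi : {lrmorphism A -> B}) (t : base_pts n A) : base_pts n B :=
  exist _ (phi (proj1_sig t)) (base_bcP phi (proj2_sig t)).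

Lemma base_bc_id (k : fieldType) (n : nat) (A : comAlgType k)
    (t : base_pts n A) : base_bc (idfun : {lrmorphism A -> A}) t = t.
Proof. exact: sig_eq. Qed.

Lemma base_bc_comp (k : fieldType) (n : nat) (A B D : comAlgType k)
    (phi : {lrmorphism A -> B}) (psi : {lrmorphism B -> D}) (t : base_pts n A) :
  base_bc (psi \o phi : {lrmorphism A -> D}) t = base_bc psi (base_bc phi t).
Proof. exact: sig_eq. Qed.

Definition base (k : fieldType) (n : nat) : kfunctor k :=
  KFunctor (@base_bc_id k n) (@base_bc_comp k n).

(* W_n, the pullback of W to Spec (k[t]/(t^(n+1))). *)
Definition Wn_pts (k : fieldType) (n : nat) (A : comAlgType k) : Type :=
  {w : W k A | W_pi w ^+ n.+1 = 0}.

Definition Wn_bc (k : fieldType) (n : nat) (A B : comAlgType k)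
    (phi : {lrmorphism A -> B}) (w : Wn_pts n A) : Wn_pts n B :=
  exist (fun w : W k B => W_pi w ^+ n.+1 = 0)
    (base_change phi (proj1_sig w)) (base_bcP phi (proj2_sig w)).

Lemma Wn_bc_id (k : fieldType) (n : nat) (A : comAlgType k) (w : Wn_pts n A) :
  Wn_bc (idfun : {lrmorphism A -> A}) w = w.
Proof. by apply: sig_eq; exact: base_change_id. Qed.

Lemma Wn_bc_comp (k : fieldType) (n : nat) (A B D : comAlgType k)
    (phi : {lrmorphism A -> B}) (psi : {lrmorphism B -> D}) (w : Wn_pts n A) :
  Wn_bc (psi \o phi : {lrmorphism A -> D}) w = Wn_bc psi (Wn_bc phi w).
Proof. by apply: sig_eq; exact: base_change_comp. Qed.

Definition Wn (k : fieldType) (n : nat) : kfunctor k :=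
  KFunctor (@Wn_bc_id k n) (@Wn_bc_comp k n).

Definition pi_n (k : fieldType) (n : nat) (A : comAlgType k) (w : Wn k n A) :
  base k n A := exist _ (W_pi (proj1_sig w)) (proj2_sig w).

Lemma succ_levelP (A : pzRingType) (n : nat) (t : A) :
  t ^+ n.+1 = 0 -> t ^+ n.+2 = 0.
Proof. by move=> tn; rewrite exprS tn mulr0. Qed.

Definition base_incl (k : fieldType) (n : nat) (A : comAlgType k)
    (t : base k n A) : base k n.+1 A :=
  exist _ (proj1_sig t) (succ_levelP (proj2_sig t)).

Definition Wn_incl (k : fieldType) (n : nat) (A : comAlgType k)
    (w : Wn k n A) : Wn k n.+1 A :=
  exist (fun w : W k A => W_pi w ^+ n.+2 = 0)
    (proj1_sig w) (succ_levelP (proj2_sig w)).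

(* The identification of the fiber of W over t = 0 with F_2, in coordinates. *)
Definition central_fiber_map (B : pzRingType) (c : W_coord B) : F2_coord B :=
  match c with
  | W_at v x y => F2_at x y (y * v ^+ 2) 1 v
  | W'_at v' x' y' => F2_at x' (y' * v' ^+ 2) y' v' 1
  end.

(* The graph of f_n : F_2 -> W_n: [is_fn p w] says [f_n p = w], i.e. w lies in
   the fiber over t = 0 and is sent to p by the identification above. *)
Definition is_fn (k : fieldType) (n : nat) (A : comAlgType k)
    (p : F2 k A) (w : Wn k n A) : Prop :=
  W_pi (proj1_sig w) = 0 /\
  forall (B : comAlgType k) (locB : local_alg B) (phi : {lrmorphism A -> B})
    (c : W_coord B),
    (proj1_sig (proj1_sig w)).2 B locB phi c ->
    proj1_sig p B locB phi (central_fiber_map c).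

Definition pi_equivariant (k : fieldType) (n : nat) (G : group_functor k)
    (alpha : algebraic_action G (Wn k n))
    (beta : algebraic_action G (base k n)) : Prop :=
  forall (A : comAlgType k) (g : G A) (w : Wn k n A),
    pi_n (alpha A g w) = beta A g (pi_n w).

Definition f_equivariant (k : fieldType) (n : nat) (G : group_functor k)
    (tau : algebraic_action G (F2 k))
    (alpha : algebraic_action G (Wn k n)) : Prop :=
  forall (A : comAlgType k) (g : G A) (p : F2 k A) (w : Wn k n A),
    is_fn p w -> is_fn (tau A g p) (alpha A g w).

(* As [Wn k n] is the part of [Wn k n.+1] over [base k n], the action induced on
   it by pullback is the restriction along the closed immersions. *)
Definition induces (k : fieldType) (n : nat) (G : group_functor k)
    (alpha' : algebraic_action G (Wn k n.+1))
    (beta' : algebraic_action G (base k n.+1))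
    (alpha : algebraic_action G (Wn k n))
    (beta : algebraic_action G (base k n)) : Prop :=
  (forall (A : comAlgType k) (g : G A) (w : Wn k n A),
     Wn_incl (alpha A g w) = alpha' A g (Wn_incl w)) /\
  (forall (A : comAlgType k) (g : G A) (t : base k n A),
     base_incl (beta A g t) = beta' A g (base_incl t)).

(* Main.v *)
(* Already the action on the thickening t^3 = 0 cannot exist.  The translations by
   the binary quadratic forms e u^2 and e' v^2, with e^2 = e'^2 = 0, commute, and
   so must their lifts.  The fibres of the family over the v-line are projective
   lines, so a lift acts on v alone, by v |-> v + e (t X(v) + t^2 Y(v)) with X and
   Y polynomials.  Let X1, X2 belong to the two translations.  The torus element
   v |-> 2v commutes with the first one, which forces X1 to be a monomial; the
   exchange of u and v carries the first to the second, so that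
   X2(v) = - v^2 X1(1/v) / chi, where t |-> chi t is the action of the exchange on
   the base.  Comparing the two charts of the family, whose gluing is nontrivial
   to first order in t, the commutation in the fibre direction at order t says
   that the constant coefficient a of X1 and the v^2-coefficient b of X2 have sum
   1.  Hence X1 = a and X2 = b v^2 with b = - a / chi, while the commutation on v
   at order t^2, i.e. [X1, X2] = 0 up to multiples of X1 and X2, gives a b = 0. *)

(* Nothing is known of a lift beyond naturality, the group law and its restriction to t = 0, and
   points are given only by germs, up to scaling and choice of chart. Most of the work is therefore
   to show that a lift has coordinate formulas at all. Over an algebra E[v] with E local Artinian,
   the local fractions describing the image of a universal point stay in one chart because they do
   so modulo nilpotents, and they glue to polynomials in v. Naturality then carries the formulas to
   every algebra. The fibre coordinate p is kept nilpotent, so the formulas describe a neighbourhood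
   of the section x = 0, which is enough for comparing coefficients.

   The action on the base has to be carried along. A translation could a priori act by t |-> t + e
   (c0 t + c1 t^2). The dilation x |-> 2x conjugates the translation by e to that by 2e while acting
   on the base by a scalar to first order, which forces c0 = 0; the surviving c1 account for the
   multiples of X1 and X2 in the bracket relation. *)
From HB Require Import structures.
Require Import Defs.
From mathcomp Require Import all_boot all_algebra all_classical all_reals.
From mathcomp Require Import ring zify.

Set Implicit Arguments.
Unset Strict Implicit.
Unset Printing Implicit Defensive.

Import GRing.Theory.
Local Open Scope ring_scope.

(** * Truncated polynomial algebras *)

(* [(a, (b, c))] stands for [a + b e + c e^2] in [B[e]/(e^3)]. *)
Definition trunc3 (B : Type) : Type := (B * (B * B))%type.

Section Trunc3Ring.
Variables (k : fieldType) (B : comAlgType k).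
Local Notation N := (trunc3 B).

HB.instance Definition _ := GRing.Zmodule.copy N (B * (B * B))%type.

Definition mk3 (a b c : B) : N := (a, (b, c)).
Definition co0 (x : N) : B := x.1.
Definition co1 (x : N) : B := x.2.1.
Definition co2 (x : N) : B := x.2.2.

Lemma eq3 (x y : N) : co0 x = co0 y -> co1 x = co1 y -> co2 x = co2 y -> x = y.
Proof. by case: x => a [b c]; case: y => a' [b' c']; rewrite /co0 /co1 /co2 /= => -> -> ->. Qed.

Definition one3 : N := mk3 1 0 0.
Definition mul3 (x y : N) : N :=
  mk3 (co0 x * co0 y) (co0 x * co1 y + co1 x * co0 y)
      (co0 x * co2 y + co1 x * co1 y + co2 x * co0 y).
Definition scale3 (c : k) (x : N) : N := mk3 (c *: co0 x) (c *: co1 x) (c *: co2 x).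

Lemma mul3A : associative mul3.
Proof. by move=> x y z; apply: eq3; rewrite /mul3 /co0 /co1 /co2 /=; ring. Qed.
Lemma mul3C : commutative mul3.
Proof. by move=> x y; apply: eq3; rewrite /mul3 /co0 /co1 /co2 /=; ring. Qed.
Lemma mul31 : left_id one3 mul3.
Proof. by move=> x; apply: eq3; rewrite /mul3 /co0 /co1 /co2 /=; ring. Qed.
Lemma mul3Dl : left_distributive mul3 +%R.
Proof. by move=> x y z; apply: eq3; rewrite /mul3 /co0 /co1 /co2 /=; ring. Qed.
Lemma one3_neq0 : one3 != 0.
Proof. by apply/eqP => /(congr1 co0) /eqP; rewrite /co0 /= oner_eq0. Qed.

HB.instance Definition _ :=
  GRing.Zmodule_isComNzRing.Build N mul3A mul3C mul31 mul3Dl one3_neq0.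

Lemma scale3A a b v : scale3 a (scale3 b v) = scale3 (a * b) v.
Proof. by rewrite /scale3 /mk3 /co0 /co1 /co2 /= !scalerA. Qed.
Lemma scale31 : left_id 1 scale3.
Proof. by move=> [a [b c]]; rewrite /scale3 /mk3 /co0 /co1 /co2 /= !scale1r. Qed.
Lemma scale3Dr : right_distributive scale3 +%R.
Proof. by move=> a x y; rewrite /scale3 /mk3 /co0 /co1 /co2 /= !scalerDr. Qed.
Lemma scale3Dl v : {morph scale3^~ v : a b / a + b}.
Proof. by move=> a b; rewrite /scale3 /mk3 /co0 /co1 /co2 /= !scalerDl. Qed.

HB.instance Definition _ :=
  GRing.Zmodule_isLmodule.Build k N scale3A scale31 scale3Dr scale3Dl.

Lemma scale3Al (a : k) (x y : N) : a *: (x * y) = (a *: x) * y.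
Proof.
by apply: eq3; rewrite /co0 /co1 /co2 /= -?scalerAl ?scalerDr -?scalerAl -?scalerAr.
Qed.

HB.instance Definition _ := GRing.Lmodule_isLalgebra.Build k N scale3Al.
HB.instance Definition _ := GRing.Lalgebra_isComAlgebra.Build k N.

Lemma co0M (x y : N) : co0 (x * y) = co0 x * co0 y. Proof. by []. Qed.
Lemma co1M (x y : N) : co1 (x * y) = co0 x * co1 y + co1 x * co0 y. Proof. by []. Qed.
Lemma co2M (x y : N) : co2 (x * y) = co0 x * co2 y + co1 x * co1 y + co2 x * co0 y.
Proof. by []. Qed.
Lemma co0D (x y : N) : co0 (x + y) = co0 x + co0 y. Proof. by []. Qed.
Lemma co1D (x y : N) : co1 (x + y) = co1 x + co1 y. Proof. by []. Qed.
Lemma co2D (x y : N) : co2 (x + y) = co2 x + co2 y. Proof. by []. Qed.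
Lemma co0N (x : N) : co0 (- x) = - co0 x. Proof. by []. Qed.
Lemma co1N (x : N) : co1 (- x) = - co1 x. Proof. by []. Qed.
Lemma co2N (x : N) : co2 (- x) = - co2 x. Proof. by []. Qed.
Lemma co01 : co0 (1 : N) = 1. Proof. by []. Qed.
Lemma co11 : co1 (1 : N) = 0. Proof. by []. Qed.
Lemma co21 : co2 (1 : N) = 0. Proof. by []. Qed.
Lemma co00 : co0 (0 : N) = 0. Proof. by []. Qed.
Lemma co10 : co1 (0 : N) = 0. Proof. by []. Qed.
Lemma co20 : co2 (0 : N) = 0. Proof. by []. Qed.
Lemma co0Z (a : k) (x : N) : co0 (a *: x) = a *: co0 x. Proof. by []. Qed.
Lemma co1Z (a : k) (x : N) : co1 (a *: x) = a *: co1 x. Proof. by []. Qed.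
Lemma co2Z (a : k) (x : N) : co2 (a *: x) = a *: co2 x. Proof. by []. Qed.
Lemma co0mk a b c : co0 (mk3 a b c) = a. Proof. by []. Qed.
Lemma co1mk a b c : co1 (mk3 a b c) = b. Proof. by []. Qed.
Lemma co2mk a b c : co2 (mk3 a b c) = c. Proof. by []. Qed.

Definition co3E := (co0M, co1M, co2M, co0D, co1D, co2D, co0N, co1N, co2N,
  co01, co11, co21, co00, co10, co20, co0Z, co1Z, co2Z, co0mk, co1mk, co2mk).
End Trunc3Ring.

(** The square of [gen3] is itself square-zero, so a single kind of truncation supplies both a t
    with t^3 = 0 and parameters e with e^2 = 0. *)
Definition gen3 (k : fieldType) (B : comAlgType k) : trunc3 B := mk3 0 1 0.
Arguments gen3 {k B}.

Definition cst3 (k : fieldType) (B : comAlgType k) (b : B) : trunc3 B := mk3 b 0 0.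

Section Lift3.
Variables (k : fieldType) (B A : comAlgType k).
(** Serves in two roles: as the morphism sending the generator to a cube-zero [e], and as the value
    at [e] of a truncated polynomial in the fibre coordinate. *)
Definition lift3 (phi : {lrmorphism B -> A}) (e : A) (x : trunc3 B) : A :=
   phi (co0 x) + phi (co1 x) * e + phi (co2 x) * e ^+ 2.

Variables (phi : {lrmorphism B -> A}) (e : A) (e3 : e ^+ 3 = 0).

(* The unused proof argument makes the morphism structures below inferable. *)
Definition liftm of e ^+ 3 = 0 := lift3 phi e.
Local Notation f := (liftm e3).
Lemma liftm_linear : linear f.
Proof.
move=> a x y; rewrite /liftm /lift3 !co3E.
rewrite !linearP /= !scalerDr !scalerAl.
ring.
Qed.
HB.instance Definition _ := GRing.isLinear.Build k (trunc3 B) A *:%R f liftm_linear.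
Lemma liftm_mult : monoid_morphism f.
Proof.
split; first by rewrite /liftm /lift3 !co3E rmorph1 rmorph0 !mul0r !addr0.
move=> x y; rewrite /liftm /lift3 !co3E !rmorphD !rmorphM /=.
have e4 : e ^+ 4 = 0 by rewrite exprS e3 mulr0.
ring: e3 e4.
Qed.
HB.instance Definition _ := GRing.isMonoidMorphism.Build (trunc3 B) A f liftm_mult.
End Lift3.

Section Cst3.
Variables (k : fieldType) (B : comAlgType k).
Lemma cst3_linear : linear (@cst3 k B).
Proof.
move=> a x y; rewrite /cst3; apply: eq3; rewrite ?co3E //;
  by rewrite /co1 /co2 /= scaler0 addr0.
Qed.
HB.instance Definition _ := GRing.isLinear.Build k B (trunc3 B) *:%R (@cst3 k B) cst3_linear.
Lemma cst3_mult : monoid_morphism (@cst3 k B).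
Proof. by split => // x y; apply: eq3; rewrite !co3E //; ring. Qed.
HB.instance Definition _ := GRing.isMonoidMorphism.Build B (trunc3 B) (@cst3 k B) cst3_mult.
Definition cst3m : {lrmorphism B -> trunc3 B} := @cst3 k B.
Lemma gen3_cube : (gen3 : trunc3 B) ^+ 3 = 0.
Proof. rewrite !exprS expr0; apply: eq3; rewrite !co3E; ring. Qed.
End Cst3.

Local Open Scope classical_set_scope.

(** * Points of the family *)

Section Tuples.
Variable B : comPzRingType.

Definition unimod2 (x y : B) : Prop := exists a b, a * x + b * y = 1.

Definition peq (x y x' y' : B) : Prop :=
  unimod2 x y /\ exists l m, l * m = 1 /\ x' = l * x /\ y' = l * y.

Lemma unimodular2E (x y : B) : unimodular [:: x; y] <-> unimod2 x y.
Proof.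
split=> [[w]|[a [b h]]]; last first.
  by exists [:: a; b]; rewrite /= !big_cons big_nil addr0.
case: w => [|a [|b w]] /=.
- rewrite big_nil => h; exists 0, 0; by rewrite !mul0r addr0.
- rewrite !big_cons big_nil => h; exists a, 0; by rewrite mul0r.
- rewrite !big_cons; case: w => [|? ?]; rewrite big_nil addr0 => h; by exists a, b.
Qed.

Lemma unimodular3E (x y z : B) :
  unimodular [:: x; y; z] <-> exists a b c, a * x + b * y + c * z = 1.
Proof.
split=> [[w]|[a [b [c h]]]]; last first.
  by exists [:: a; b; c]; rewrite /= !big_cons big_nil addr0 addrA.
case: w => [|a [|b [|c w]]] /=.
- rewrite big_nil => h; exists 0, 0, 0; by rewrite !mul0r !addr0.
- rewrite !big_cons big_nil => h; exists a, 0, 0; by rewrite !mul0r addr0.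
- rewrite !big_cons big_nil => h; exists a, b, 0; by rewrite !mul0r -addrA.
- rewrite !big_cons; case: w => [|? ?]; rewrite big_nil addr0 addrA => h; by exists a, b, c.
Qed.

Lemma proj_eq2E (x y x' y' : B) :
  proj_eq [:: x; y] [:: x'; y'] <-> peq x y x' y'.
Proof.
rewrite /proj_eq unimodular2E; split.
  by move=> [u [l [[m lm] /= [-> ->]]]]; split=> //; exists l, m.
by move=> [u [l [m [lm [-> ->]]]]]; split=> //; exists l; split=> //; exists m.
Qed.

Lemma peq_refl (x y : B) : unimod2 x y -> peq x y x y.
Proof. by move=> u; split=> //; exists 1, 1; rewrite !mul1r. Qed.

Lemma peq_unimodr (x y x' y' : B) : peq x y x' y' -> unimod2 x' y'.
Proof.
move=> [[a [b h]] [l [m [lm [-> ->]]]]]; exists (a * m), (b * m).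
by rewrite -h; ring: lm.
Qed.

Lemma peq_sym (x y x' y' : B) : peq x y x' y' -> peq x' y' x y.
Proof.
move=> h; split; first exact: peq_unimodr h.
case: h => _ [l [m [lm [-> ->]]]]; exists m, l; split; first by rewrite mulrC.
by split; ring: lm.
Qed.

Lemma peq_trans (x y x' y' x'' y'' : B) :
  peq x y x' y' -> peq x' y' x'' y'' -> peq x y x'' y''.
Proof.
move=> [u [l [m [lm [-> ->]]]]] [_ [l' [m' [lm' [-> ->]]]]]; split=> //.
exists (l * l'), (m * m'); split; first by ring: lm lm'.
by split; ring.
Qed.

Definition at_chart (b : bool) (v x y : B) : W_coord B :=
  if b then W'_at v x y else W_at v x y.

Definition sgn (b : bool) (t : B) : B := if b then - t else t.

Lemma sgnN b t : sgn (~~ b) t = - sgn b t.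
Proof. by case: b; rewrite //= opprK. Qed.

Lemma W_tupleP (c : W_coord B) : exists b v x y, c = at_chart b v x y.
Proof. by case: c => v x y; [exists false, v, x, y|exists true, v, x, y]. Qed.

Lemma W_same_eq t b v x y v' x' y' :
  W_same t (at_chart b v x y) (at_chart b v' x' y') <-> v' = v /\ peq x y x' y'.
Proof. by case: b; rewrite /= proj_eq2E. Qed.

(** Solving y' = y v^2 - s v x for y by means of v v' = 1 gives y = y' v'^2 + s v' x: the inverse
    transition is the transition with s negated. *)
Lemma peq_flip s v v' x y x' y' : v * v' = 1 ->
  peq x y x' (y' * v' ^+ 2 - s * v' * x') -> peq x (y * v ^+ 2 + s * v * x) x' y'.
Proof.
move=> h [[a [b u]] [l [m [lm [e1 e2]]]]]; split.
  exists (a - b * s * v'), (b * v' ^+ 2).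
  have -> : (a - b * s * v') * x + b * v' ^+ 2 * (y * v ^+ 2 + s * v * x)
     = a * x + b * y * (v * v') ^+ 2 + b * s * v' * x * ((v * v') - 1) by ring.
  by rewrite h subrr mulr0 addr0 expr1n mulr1.
exists l, m; do 2!split=> //.
have -> : y' = v ^+ 2 * (y' * v' ^+ 2 - s * v' * x') + s * v * x' * (v * v')
               - y' * ((v * v') ^+ 2 - 1) by ring.
by rewrite e2 e1 h expr1n; ring.
Qed.

Lemma peq_flipE s v v' x y x' y' : v * v' = 1 ->
  peq x (y * v ^+ 2 + s * v * x) x' y' <->
  peq x' (y' * v' ^+ 2 - s * v' * x') x y.
Proof.
move=> h; split; last by move=> /peq_sym /(peq_flip h).
move=> p; have h' : v' * v = 1 by rewrite mulrC.
rewrite -!mulNr; apply: peq_flip h' _.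
rewrite !mulNr opprK; exact: peq_sym.
Qed.

(* The gluing of the two charts is symmetric up to the sign of [t]. *)
Lemma W_same_neq t b v x y v' x' y' :
  W_same t (at_chart b v x y) (at_chart (~~ b) v' x' y') <->
  v * v' = 1 /\ peq x (y * v ^+ 2 - sgn b t * v * x) x' y'.
Proof.
case: b; rewrite /= /W_overlap proj_eq2E //.
rewrite !mulNr opprK; split=> -[h p]; (have h' := h; rewrite mulrC in h'; split=> //).
- exact/(peq_flipE t _ _ _ _ h').
- exact/(peq_flipE t _ _ _ _ h).
Qed.

Lemma W_same_sym t (c d : W_coord B) : W_same t c d -> W_same t d c.
Proof.
case: c => v x y; case: d => v' x' y' //=; rewrite !proj_eq2E => -[-> /peq_sym p];
  by split.
Qed.

Definition admissible (c : W_coord B) : Prop :=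
  match c with W_at _ x y => unimod2 x y | W'_at _ x y => unimod2 x y end.

Lemma admissible_at b v x y : admissible (at_chart b v x y) = unimod2 x y.
Proof. by case: b. Qed.

Lemma W_same_refl t c : admissible c -> W_same t c c.
Proof. by case: c => v x y /= u; rewrite proj_eq2E; split=> //; exact: peq_refl. Qed.

(** The transition is the linear map (x, y) |-> (x, y v^2 - s v x), invertible because v is a unit,
    so it respects unimodularity and proportionality. *)
Lemma peq_glue s v v' x y x' y' : v * v' = 1 -> peq x y x' y' ->
  peq x (y * v ^+ 2 - s * v * x) x' (y' * v ^+ 2 - s * v * x').
Proof.
move=> h [[a [b u]] [l [m [lm [-> ->]]]]]; split; last first.
  by exists l, m; do 2!split=> //; ring.
exists (a + b * s * v'), (b * v' ^+ 2).
have -> : (a + b * s * v') * x + b * v' ^+ 2 * (y * v ^+ 2 - s * v * x)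
   = a * x + b * y * (v * v') ^+ 2 - b * s * v' * x * ((v * v') - 1) by ring.
by rewrite h subrr mulr0 subr0 expr1n mulr1.
Qed.

Lemma W_same_trans t (c d e : W_coord B) :
  W_same t c d -> W_same t d e -> W_same t c e.
Proof.
have [b [v [x [y ->]]]] := W_tupleP c.
have [b' [v' [x' [y' ->]]]] := W_tupleP d.
have [b'' [v'' [x'' [y'' ->]]]] := W_tupleP e.
case: (eqVneq b' b) => [->|/negPf nb].
  case: (eqVneq b'' b) => [->|/negPf nb'].
    rewrite !W_same_eq => -[-> p] [-> q]; split=> //; exact: peq_trans p q.
  have -> : b'' = ~~ b by move: nb'; case: b b'' => [] [].
  rewrite W_same_eq !W_same_neq => -[-> p] [h q]; split=> //.
  exact: peq_trans (peq_glue _ h p) q.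
have -> : b' = ~~ b by move: nb; case: b b' => [] [].
case: (eqVneq b'' b) => [->|/negPf nb'].
  rewrite -[b in at_chart b v'']negbK W_same_neq W_same_neq negbK W_same_eq => -[h p] [h' q].
  split; first by rewrite -[v'']mul1r -h -mulrA h' mulr1.
  have h2 : v' * v = 1 by rewrite mulrC.
  (* Leaving the chart and returning: the second transition has -t in place of t, and the composite
     is the identity because v v' = 1. *)
  have := peq_glue (- sgn b t) h2 p.
  rewrite sgnN in q; move=> /peq_trans /(_ q).
  have -> // : (y * v ^+ 2 - sgn b t * v * x) * v' ^+ 2 - - sgn b t * v' * x = y.
  have -> : (y * v ^+ 2 - sgn b t * v * x) * v' ^+ 2 - - sgn b t * v' * x =
    y + y * ((v * v') ^+ 2 - 1) - sgn b t * v' * x * (v * v' - 1) by ring.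
  by rewrite h expr1n !subrr !mulr0 subr0 addr0.
have -> : b'' = ~~ b by move: nb'; case: b b'' {nb} => [] [].
rewrite !W_same_neq W_same_eq => -[h p] [-> q]; split=> //; exact: peq_trans p q.
Qed.

Lemma W_same_admissible t (c d : W_coord B) : W_same t c d -> admissible d.
Proof.
move=> s; have := W_same_trans (W_same_sym s) s.
by case: d {s} => v x y /= [_]; rewrite proj_eq2E => -[].
Qed.
End Tuples.

(** Applied to the relation that the [e i * f i] sum to 1, this shows that some principal open of a
    cover contains the closed point of a local spectrum. *)
Lemma local_sum (k : fieldType) (B : comAlgType k) (locB : local_alg B) (r : nat)
    (a : 'I_r -> B) :
  invertible (\sum_(i < r) a i) -> exists i, invertible (a i).
Proof.
elim: r a => [|r IH] a.
  by rewrite big_ord0 => -[b]; rewrite mul0r => /esym/eqP; rewrite oner_eq0.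
rewrite big_ord_recr /= => -[b]; rewrite mulrDl => h.
have [[c hc]|[c hc]] := locB ((\sum_(i < r) a (widen_ord (leqnSn r) i)) * b).
  have [|i hi] := IH (fun i => a (widen_ord (leqnSn r) i)).
    by exists (b * c); rewrite mulrA.
  by eexists; exact: hi.
exists ord_max, (b * c); rewrite mulrA -hc -h; ring.
Qed.

Lemma invertible_factor (B : comPzRingType) (a b : B) :
  invertible (a * b) -> invertible a.
Proof. by move=> [c h]; exists (b * c); rewrite mulrA. Qed.

Section Points.
Variables (k : fieldType) (n : nat).

Definition germ_of (A : comAlgType k) (w : Wn k n A) := (proj1_sig (proj1_sig w)).2.

Definition germ_glued (A : comAlgType k) (w : Wn k n A) := proj2_sig (proj1_sig w).

Lemma germ_bc (A A' : comAlgType k) (rho : {lrmorphism A -> A'}) (w : Wn k n A)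
    (B : comAlgType k) (locB : local_alg B) (phi : {lrmorphism A' -> B}) :
  germ_of (base_change rho w) locB phi = germ_of w locB (phi \o rho : {lrmorphism A -> B}).
Proof. by []. Qed.

(* [w] is the point with coordinates [(t, c)]. *)
Definition is_pt (A : comAlgType k) (w : Wn k n A) (t : A) (c : W_coord A) : Prop :=
  [/\ W_pi (proj1_sig w) = t, admissible c &
    forall (B : comAlgType k) (locB : local_alg B) (phi : {lrmorphism A -> B}),
      germ_of w locB phi = [set q | W_same (phi t) (cmap phi c) q]].

Lemma admissible_map (A B : comAlgType k) (phi : {lrmorphism A -> B}) (c : W_coord A) :
  admissible c -> admissible (cmap phi c).
Proof.
by case: c => v x y [a [b h]]; exists (phi a), (phi b);
  rewrite -!rmorphM -rmorphD h rmorph1.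
Qed.

Lemma is_pt_unique (A : comAlgType k) (w w' : Wn k n A) t c :
  is_pt w t c -> is_pt w' t c -> w = w'.
Proof.
move: w w' => [[[s g] gP] sP] [[[s' g'] gP'] sP'] [/= e _ gE] [/= e' _ gE'].
have e1 : s = t := e; have e2 : s' = t := e'.
apply: sig_eq => /=; apply: sig_eq => /=; rewrite e1 e2; congr pair.
by apply: germs_eq => B locB phi; exact: etrans (gE B locB phi) (esym (gE' B locB phi)).
Qed.

Lemma is_pt_exists (A : comAlgType k) (t : A) (c : W_coord A) :
  t ^+ n.+1 = 0 -> admissible c -> exists w : Wn k n A, is_pt w t c.
Proof.
move=> tn adm.
pose g : germs W_coord A := fun B locB phi => [set q | W_same (phi t) (cmap phi c) q].
have gP : glued_point (fun B (phi : {lrmorphism A -> B}) => W_same (phi (t, g).1)) (t, g).2.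
  exists 1%N, (fun=> 1), (fun=> 1); split; first by rewrite big_ord1 mul1r.
  move=> i; exists c, 0%N => B locB phi b _.
  rewrite (_ : frac_tuple phi b 0 _ = cmap phi c); last first.
    by rewrite /frac_tuple; case: (c) => v x y /=; rewrite !mulr1.
  by split=> //; apply: W_same_refl; exact: admissible_map.
pose w1 : W k A := exist _ (t, g) gP.
by exists (exist (fun w : W k A => W_pi w ^+ n.+1 = 0) w1 tn); split.
Qed.

Lemma is_pt_bc (A A' : comAlgType k) (rho : {lrmorphism A -> A'}) (w : Wn k n A) t c :
  is_pt w t c -> is_pt (base_change rho w) (rho t) (cmap rho c).
Proof.
move=> [<- adm gE]; split=> //; first exact: admissible_map.
by move=> B locB phi; rewrite germ_bc gE W_cmap_comp.
Qed.

Lemma germ_local (A : comAlgType k) (w : Wn k n A) (B : comAlgType k)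
    (locB : local_alg B) (phi : {lrmorphism A -> B}) :
  exists c : W_coord B,
   admissible c /\ germ_of w locB phi = [set q | W_same (phi (W_pi (proj1_sig w))) c q].
Proof.
have [r [f [e [ef H]]]] := germ_glued w.
have [|i] := @local_sum k B locB r (fun i => phi (e i) * phi (f i)).
  exists 1; rewrite mulr1 -(rmorph1 phi) -ef rmorph_sum.
  by apply: eq_bigr => j _; rewrite rmorphM.
rewrite mulrC => /invertible_factor [b hb].
have [p [m Hp]] := H i; have [same gE] := Hp B locB phi b hb.
by exists (frac_tuple phi b m p); split=> //; exact: W_same_admissible same.
Qed.

(** A germ is a full equivalence class, so it is determined as soon as it meets the class of [c]. *)
Lemma is_pt_intro (A : comAlgType k) (w : Wn k n A) t c :
  W_pi (proj1_sig w) = t -> admissible c ->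
  (forall (B : comAlgType k) (locB : local_alg B) (phi : {lrmorphism A -> B}),
     exists q, germ_of w locB phi q /\ W_same (phi t) (cmap phi c) q) ->
  is_pt w t c.
Proof.
move=> wt adm H; split=> // B locB phi.
have [q []] := H B locB phi; have [d [_ ->]] := germ_local w locB phi.
rewrite wt /= => dq cq; apply/seteqP; split=> q' /= s.
  exact: W_same_trans cq (W_same_trans (W_same_sym dq) s).
exact: W_same_trans dq (W_same_trans (W_same_sym cq) s).
Qed.

Lemma is_pt_same (A : comAlgType k) (w : Wn k n A) t c c' :
  is_pt w t c -> W_same t c c' -> is_pt w t c'.
Proof.
move=> [wt adm gE] s; apply: is_pt_intro => //; first exact: W_same_admissible s.
move=> B locB phi; exists (cmap phi c); rewrite gE /=; split.
  by apply: W_same_refl; exact: admissible_map.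
apply: W_same_sym; move: s.
have pe x y x' y' : peq x y x' y' -> peq (phi x) (phi y) (phi x') (phi y').
  move=> [[a [b u]] [l [m [lm [-> ->]]]]]; split.
    by exists (phi a), (phi b); rewrite -!rmorphM -rmorphD u rmorph1.
  by exists (phi l), (phi m); rewrite -!rmorphM lm rmorph1.
case: (c) => v x y; case: (c') => v' x' y' /=; rewrite /W_overlap !proj_eq2E.
- by move=> [-> /pe].
- move=> [vv /pe]; rewrite rmorphB rmorphM rmorphXn !rmorphM => p; split=> //.
  by rewrite -rmorphM vv rmorph1.
- move=> [vv /pe]; rewrite rmorphB rmorphM rmorphXn !rmorphM => p; split=> //.
  by rewrite -rmorphM vv rmorph1.
- by move=> [-> /pe].
Qed.

(** When [A] is local its identity is one of the test morphisms, and the germ there is the class of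
    the tuple itself. *)
Lemma is_pt_inj (A : comAlgType k) (locA : local_alg A) (w : Wn k n A) t c t' c' :
  is_pt w t c -> is_pt w t' c' -> t = t' /\ W_same t c c'.
Proof.
have cid (d : W_coord A) : cmap (idfun : {lrmorphism A -> A}) d = d by case: d.
move=> [<- _ gE] [<- adm' gE']; split=> //.
have := gE' A locA (idfun : {lrmorphism A -> A}).
rewrite (gE A locA (idfun : {lrmorphism A -> A})) !cid /= => /(congr1 (fun S => S c')) /= ->.
exact: W_same_refl.
Qed.
End Points.

(** * Linear automorphisms of F_2 *)

(* [Lin l a b c d s] stands for ([x:y:z],[u:v]) |-> ([lx+ay+bz : c^2 y : d^2 z], [cu:dv]),
   followed, if [s] holds, by the exchange of y with z and of u with v. *)
Record linear_map (B : Type) := Lin {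
  lx : B; ly : B; lz : B; lu : B; lv : B; lswap : bool }.

Definition lin_map (A B : Type) (f : A -> B) (p : linear_map A) : linear_map B :=
  Lin (f (lx p)) (f (ly p)) (f (lz p)) (f (lu p)) (f (lv p)) (lswap p).

Section Linear.
Variable B : comPzRingType.
Implicit Types p : linear_map B.

Definition lin_apply p (q : F2_coord B) : F2_coord B :=
  let: F2_at x y z u v := q in
  let x' := lx p * x + ly p * y + lz p * z in
  let y' := lu p ^+ 2 * y in let z' := lv p ^+ 2 * z in
  let u' := lu p * u in let v' := lv p * v in
  if lswap p then F2_at x' z' y' v' u' else F2_at x' y' z' u' v'.

Definition lin_one : linear_map B := Lin 1 0 0 1 1 false.

(** Composition, with [p'] acting before [p]; an exchange in [p'] makes [p] meet y and z, and u and
    v, in the opposite roles. *)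
Definition lin_mul p p' : linear_map B :=
  let s := lswap p' in
  Lin (lx p * lx p')
      (lx p * ly p' + (if s then lz p else ly p) * lu p' ^+ 2)
      (lx p * lz p' + (if s then ly p else lz p) * lv p' ^+ 2)
      ((if s then lv p else lu p) * lu p')
      ((if s then lu p else lv p) * lv p') (lswap p (+) s).

Lemma lin_apply1 q : lin_apply lin_one q = q.
Proof. by case: q => x y z u v; rewrite /lin_apply /=; congr F2_at; ring. Qed.

Lemma lin_applyM p p' q : lin_apply (lin_mul p p') q = lin_apply p (lin_apply p' q).
Proof.
case: p p' q => l a b c d [] [l' a' b' c' d' []] [x y z u v];
  rewrite /lin_apply /=; congr F2_at; ring.
Qed.

Definition lin_inverse p p' : Prop := lin_mul p p' = lin_one /\ lin_mul p' p = lin_one.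

Lemma lin_cancel p p' : lin_inverse p p' -> cancel (lin_apply p) (lin_apply p').
Proof. by move=> [_ h] q; rewrite -lin_applyM h lin_apply1. Qed.

Lemma lin_inverse_sym p p' : lin_inverse p p' -> lin_inverse p' p.
Proof. by case. Qed.

Definition F2_unimod (q : F2_coord B) : Prop :=
  let: F2_at x y z u v := q in
  (exists a b c, a * x + b * y + c * z = 1) /\ (exists a b, a * u + b * v = 1).

Definition F2_scale l m (q : F2_coord B) : F2_coord B :=
  let: F2_at x y z u v := q in F2_at (l * x) (l * y) (l * z) (m * u) (m * v).

Definition F2_eqn (q : F2_coord B) : Prop :=
  let: F2_at x y z u v := q in y * v ^+ 2 = z * u ^+ 2.

Lemma F2_sameE q r : F2_same q r <-> [/\ F2_eqn q, F2_unimod q &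
  exists l m, invertible l /\ invertible m /\ r = F2_scale l m q].
Proof.
case: q r => x y z u v [x' y' z' u' v']; rewrite /F2_same /proj_eq.
rewrite (propext (unimodular3E x y z)) (propext (unimodular2E u v)).
split=> [[e [U [l [li [-> -> ->]]]] [U' [m [mi [-> ->]]]]]|
        [e [U U'] [l [m [li [mi [-> -> -> -> ->]]]]]]].
  by split=> //; exists l, m.
by split=> //; split=> //; [exists l|exists m].
Qed.

Lemma lin_scale p l m q : lin_apply p (F2_scale l m q) = F2_scale l m (lin_apply p q).
Proof. case: p q => pl a b c d [] [x y z u v] /=; congr F2_at; ring. Qed.

Lemma lin_eqn p q : F2_eqn q -> F2_eqn (lin_apply p q).
Proof.
case: p q => pl a b c d [] [x y z u v] /= h.
  transitivity (c ^+ 2 * d ^+ 2 * (z * u ^+ 2)); first by ring.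
  by rewrite -h; ring.
transitivity (c ^+ 2 * d ^+ 2 * (y * v ^+ 2)); first by ring.
by rewrite h; ring.
Qed.

Lemma lin_unimod p q : F2_unimod (lin_apply p q) -> F2_unimod q.
Proof.
case: p q => pl a b c d [] [x y z u v] /= [[A [B' [C h]]] [D [E h']]]; split.
- exists (A * pl), (A * a + C * c ^+ 2), (A * b + B' * d ^+ 2); rewrite -h; ring.
- exists (E * c), (D * d); rewrite -h'; ring.
- exists (A * pl), (A * a + B' * c ^+ 2), (A * b + C * d ^+ 2); rewrite -h; ring.
- exists (D * c), (E * d); rewrite -h'; ring.
Qed.

Lemma lin_same p p' q r : lin_inverse p p' -> F2_same q r ->
  F2_same (lin_apply p q) (lin_apply p r).
Proof.
move=> pp'; rewrite !F2_sameE => -[e U [l [m [li [mi ->]]]]]; split.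
- exact: lin_eqn.
- by apply: (@lin_unimod p'); rewrite (lin_cancel pp').
- by exists l, m; rewrite lin_scale.
Qed.

Lemma lin_sameE p p' q r : lin_inverse p p' ->
  F2_same (lin_apply p q) r <-> F2_same q (lin_apply p' r).
Proof.
move=> pp'; split=> h.
  by rewrite -(lin_cancel pp' q); apply: lin_same (lin_inverse_sym pp') h.
rewrite -[r](lin_cancel (lin_inverse_sym pp')); exact: lin_same pp' h.
Qed.
End Linear.

Section LinearAut.
Variable k : fieldType.

Lemma lin_map_comp (A B D : Type) (f : A -> B) (g : B -> D) p :
  lin_map g (lin_map f p) = lin_map (fun a => g (f a)) p.
Proof. by []. Qed.

Lemma lin_map_mul (A B : comAlgType k) (phi : {lrmorphism A -> B}) q q' :
  lin_mul (lin_map phi q) (lin_map phi q') = lin_map phi (lin_mul q q').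
Proof.
by case: q q' => l a b c d s [l' a' b' c' d' []];
  rewrite /lin_mul /lin_map /= !(rmorphD, rmorphXn, rmorphM).
Qed.

Lemma lin_inverse_map (A B : comAlgType k) (phi : {lrmorphism A -> B}) p p' :
  lin_inverse p p' -> lin_inverse (lin_map phi p) (lin_map phi p').
Proof.
have O : lin_map phi (lin_one A) = lin_one B.
  by rewrite /lin_map /= rmorph0 rmorph1.
by move=> [h h']; split; rewrite lin_map_mul ?h ?h'.
Qed.

Lemma lin_frac (A B : comAlgType k) (phi : {lrmorphism A -> B}) b m p (q : F2_coord A) :
  frac_tuple phi b m (lin_apply p q : F2_coord A) =
  lin_apply (lin_map phi p) (frac_tuple phi b m q).
Proof.
case: p q => l a' b' c d [] [x y z u v]; rewrite /frac_tuple /=;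
  congr F2_at; rewrite !(rmorphD, rmorphXn, rmorphM, mulrDl) -?mulrA //.
Qed.

(** The direct image of germs under an automorphism, written as the inverse image under its inverse
    [p']. For this reason identities between automorphisms are checked on the inverses, multiplied
    in the opposite order. *)
Definition lin_germs (A : comAlgType k) (p' : linear_map A) (x : germs F2_coord A) :
    germs F2_coord A :=
  fun B locB phi => [set q | x B locB phi (lin_apply (lin_map phi p') q)].

Lemma lin_germs_glued (A : comAlgType k) p p' (x : germs F2_coord A) :
  lin_inverse p p' ->
  glued_point (fun B (phi : {lrmorphism A -> B}) => @F2_same B) x ->
  glued_point (fun B (phi : {lrmorphism A -> B}) => @F2_same B) (lin_germs p' x).
Proof.
move=> pp' [r [f [e [ef H]]]]; exists r, f, e; split=> // i.
have [q [m Hq]] := H i; exists (lin_apply p q), m => B locB phi b hb.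
have [s gE] := Hq B locB phi b hb; have pp := lin_inverse_map phi pp'.
rewrite lin_frac; split; first exact: lin_same pp s.
rewrite /lin_germs gE; apply/seteqP; split=> z /=.
  by move/(lin_sameE _ _ pp).
by move=> h; apply/(lin_sameE _ _ pp).
Qed.

Definition lin_point (A : comAlgType k) p p' (pp' : lin_inverse p p') (x : F2 k A) : F2 k A :=
  exist _ (lin_germs p' (proj1_sig x)) (lin_germs_glued pp' (proj2_sig x)).

Lemma lin_is_aut (A : comAlgType k) (p p' : linear_map A) (pp' : lin_inverse p p') :
  is_aut (fun B phi => @lin_point B _ _ (lin_inverse_map phi pp')).
Proof.
split; first by move=> B D phi psi y; apply: sig_eq.
exists (fun B phi => @lin_point B _ _ (lin_inverse_map phi (lin_inverse_sym pp'))); split.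
  by move=> B D phi psi y; apply: sig_eq.
move=> B phi; split=> y; apply: sig_eq; apply: germs_eq => D locD psi; apply/funext => q /=;
  rewrite /lin_germs /mkset lin_map_comp.
  by congr (proj1_sig y D locD psi _);
    exact: (lin_cancel (lin_inverse_map (psi \o phi : {lrmorphism A -> D}) pp')).
by congr (proj1_sig y D locD psi _);
  exact: (lin_cancel (lin_inverse_sym (lin_inverse_map (psi \o phi : {lrmorphism A -> D}) pp'))).
Qed.

Definition lin_aut (A : comAlgType k) (p p' : linear_map A) (pp' : lin_inverse p p') :
  Aut (F2 k) A := exist _ _ (lin_is_aut pp').

Lemma lin_aut_eq (A : comAlgType k) (p p' q q' : linear_map A)
    (pp' : lin_inverse p p') (qq' : lin_inverse q q') :
  p' = q' -> lin_aut pp' = lin_aut qq'.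
Proof.
move=> e; apply: sig_eq; apply: aut_family_eq => B phi y; apply: sig_eq => /=.
by rewrite e.
Qed.

Lemma lin_autM (A : comAlgType k) (p p' q q' r r' : linear_map A)
    (pp' : lin_inverse p p') (qq' : lin_inverse q q') (rr' : lin_inverse r r') :
  lin_mul q' p' = r' -> gmul (lin_aut pp') (lin_aut qq') = lin_aut rr'.
Proof.
move=> e; apply: sig_eq; apply: aut_family_eq => B phi y; apply: sig_eq => /=.
apply: germs_eq => D locD psi; apply/funext => z; rewrite /lin_germs /mkset /=.
rewrite -lin_applyM -e; congr (proj1_sig y D locD psi (lin_apply _ z)).
exact: (lin_map_mul (psi \o phi : {lrmorphism A -> D})).
Qed.

Lemma lin_aut_relation (A : comAlgType k) (p p' q q' r r' s s' : linear_map A)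
    (pp' : lin_inverse p p') (qq' : lin_inverse q q')
    (rr' : lin_inverse r r') (ss' : lin_inverse s s') :
  lin_mul q' p' = lin_mul s' r' ->
  gmul (lin_aut pp') (lin_aut qq') = gmul (lin_aut rr') (lin_aut ss').
Proof.
move=> e; apply: sig_eq; apply: aut_family_eq => B phi y; apply: sig_eq => /=.
apply: germs_eq => D locD psi; apply/funext => z; rewrite /lin_germs /mkset /=.
congr (proj1_sig y D locD psi _); rewrite -!lin_applyM.
have M := lin_map_mul (psi \o phi : {lrmorphism A -> D}).
by congr (lin_apply _ z); apply: etrans (M _ _) (etrans _ (esym (M _ _))); rewrite e.
Qed.

Lemma lin_aut_bc (A B : comAlgType k) (phi : {lrmorphism A -> B}) (p p' : linear_map A)
    (pp' : lin_inverse p p') :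
  base_change phi (lin_aut pp') = lin_aut (lin_inverse_map phi pp').
Proof. by apply: sig_eq; apply: aut_family_eq => D psi y; apply: sig_eq. Qed.

Lemma lin_aut_one (A : comAlgType k) (p p' : linear_map A) (pp' : lin_inverse p p') :
  p' = lin_one A -> lin_aut pp' = gone (Aut (F2 k)) A.
Proof.
move=> e; apply: sig_eq; apply: aut_family_eq => B phi y; apply: sig_eq => /=.
apply: germs_eq => D locD psi; apply/funext => z; rewrite /lin_germs /mkset /= e.
rewrite (_ : lin_map _ _ = lin_one D) ?lin_apply1 //.
by rewrite /lin_map /= !rmorph0 !rmorph1.
Qed.
End LinearAut.

(** * The central fibre and the tautological action in coordinates *)

Section CentralFiber.
Variable B : comPzRingType.

Lemma central_fiber_unimod (c : W_coord B) :
  F2_unimod (central_fiber_map c) <-> admissible c.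
Proof.
case: c => v x y /=; split=> [[[a [b [d h]]] _]|[a [b h]]].
- by exists a, (b + d * v ^+ 2); rewrite -h; ring.
- split; first by exists a, b, 0; rewrite mul0r addr0.
  by exists 1, 0; rewrite mulr1 mul0r addr0.
- by exists a, (b * v ^+ 2 + d); rewrite -h; ring.
- split; first by exists a, 0, b; rewrite mul0r addr0.
  by exists 0, 1; rewrite mulr1 mul0r add0r.
Qed.

Lemma central_fiber_eqn (c : W_coord B) : F2_eqn (central_fiber_map c).
Proof. by case: c => v x y /=; rewrite !expr1n !mulr1. Qed.

Lemma central_fiber_same (c c' : W_coord B) :
  W_same 0 c c' <-> F2_same (central_fiber_map c) (central_fiber_map c').
Proof.
rewrite F2_sameE; split.
  move=> s; split; first exact: central_fiber_eqn.
    by apply/central_fiber_unimod; exact: W_same_admissible (W_same_sym s).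
  have [b [v [x [y e]]]] := W_tupleP c.
  have [b' [v' [x' [y' e']]]] := W_tupleP c'; move: s; rewrite {}e {}e'.
  case: (eqVneq b' b) => [->|/negPf nb].
    rewrite W_same_eq => -[-> [_ [l [m [lm [-> ->]]]]]].
    exists l, 1; do 2!(split; first by [exists m|exists 1; rewrite mulr1]).
    by case: b => /=; congr F2_at; ring.
  have -> : b' = ~~ b by move: nb; case: b b' => [] [].
  rewrite W_same_neq => -[vv [_ [l [m [lm [-> ->]]]]]].
  have -> : sgn b (0 : B) = 0 by case: (b) => /=; rewrite ?oppr0.
  (* The factor [v'] rescales [1:v] to [v':1], and [v:1] to [1:v'] in the opposite direction. *)
  exists l, v'; split; first by exists m.
  split; first by exists v; rewrite mulrC.
  have vv1 : v ^+ 2 * v' ^+ 2 = 1 by rewrite -exprMn vv expr1n.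
  case: (b) => /=; congr F2_at; rewrite ?mul0r ?subr0; ring: vv vv1.
move=> [_ /central_fiber_unimod U [l [m [[l' li] [_ e]]]]].
case: c U e => v x y /= U; case: c' => v' x' y' /= [-> e1 e2].
- rewrite mulr1 => <-; rewrite mul1r proj_eq2E e1 => ->; split=> //.
  by split=> //; exists l, l'.
- move=> -> /esym vv; rewrite /W_overlap proj_eq2E mulr1; rewrite mulrC in vv; split=> //.
  have := peq_glue 0 vv (peq_refl U); rewrite !mul0r subr0 => -[U' _].
  by split=> //; exists l, l'; do 2!split=> //; rewrite e2.
- move=> /esym vv e3; rewrite /W_overlap proj_eq2E e3 mulr1; split; first exact: vv.
  move: e2; rewrite e3 mulr1 => e2.
  rewrite !mul0r subr0 e2; apply: peq_sym; split=> //; exists l, l'; do 2!split=> //.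
- move=> -> /esym; rewrite mulr1 => ->; rewrite mul1r proj_eq2E e2; split=> //.
  by split=> //; exists l, l'.
Qed.
End CentralFiber.

Section Tautological.
Variables (k : fieldType) (n : nat).

Lemma F2_point_exists (A : comAlgType k) (c : W_coord A) : admissible c ->
  exists p : F2 k A, forall (B : comAlgType k) (locB : local_alg B) (phi : {lrmorphism A -> B}),
    proj1_sig p B locB phi = [set q | F2_same (central_fiber_map (cmap phi c)) q].
Proof.
move=> adm.
pose g : germs F2_coord A :=
  fun B locB phi => [set q | F2_same (central_fiber_map (cmap phi c)) q].
suff gP : glued_point (fun B (phi : {lrmorphism A -> B}) => @F2_same B) g by exists (exist _ g gP).
exists 1%N, (fun=> 1), (fun=> 1); split; first by rewrite big_ord1 mul1r.
move=> i; exists (central_fiber_map c), 0%N => B locB phi b _.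
rewrite (_ : frac_tuple phi b 0 _ = central_fiber_map (cmap phi c)); last first.
  by rewrite /frac_tuple; case: (c) => v x y /=; rewrite !mulr1 ?rmorphM ?rmorphXn ?rmorph1.
split=> //; apply/central_fiber_same; apply: W_same_refl; exact: admissible_map.
Qed.

(** As the identification of the central fibre with F_2 is injective on classes of tuples,
    [f_equivariant] determines the germs of the lifted point: over t = 0 the lift is computed by the
    formula for [p]. *)
Lemma tautological_pt (alpha : algebraic_action (Aut (F2 k)) (Wn k n))
    (A : comAlgType k) (p p' : linear_map A) (pp' : lin_inverse p p')
    (w : Wn k n A) (c c' : W_coord A) :
  f_equivariant (tautological_action (F2 k)) alpha ->
  admissible c' -> lin_apply p (central_fiber_map c) = central_fiber_map c' ->
  is_pt w 0 c -> is_pt (alpha A (lin_aut pp') w) 0 c'.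
Proof.
move=> feq adm' cc' [w0 adm gE]; have [q qE] := F2_point_exists adm.
have qw : is_fn q w.
  split=> // B locB phi d gd; have : germ_of w locB phi d := gd.
  by rewrite gE rmorph0 qE => /central_fiber_same.
have [w0' H] := feq A (lin_aut pp') q w qw; apply: is_pt_intro => // B locB phi.
have [d [admd gd]] := germ_local (alpha A (lin_aut pp') w) locB phi.
have dd : germ_of (alpha A (lin_aut pp') w) locB phi d.
  by rewrite gd /=; exact: W_same_refl.
exists d; split=> //; rewrite rmorph0; apply/central_fiber_same.
have := H B locB phi d dd; rewrite /= /lin_germs /= qE /= => s.
have {}s : F2_same (lin_apply (lin_map phi p) (central_fiber_map (cmap phi c)))
    (central_fiber_map d).
  by apply/(lin_sameE _ _ (lin_inverse_map phi pp')).
move: s; have -> // : lin_apply (lin_map phi p) (central_fiber_map (cmap phi c)) =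
  central_fiber_map (cmap phi c').
have cm (e : W_coord A) : central_fiber_map (cmap phi e) = F2_cmap phi (central_fiber_map e).
  by case: e => v x y /=; rewrite rmorphM rmorphXn rmorph1.
rewrite !cm -cc'; case: (central_fiber_map c) => x y z u v.
by case: (p) => l a b c0 d0 [] /=; congr F2_at; rewrite !(rmorphD, rmorphXn, rmorphM).
Qed.
End Tautological.

Import Num.Theory.

(** * Functions on nilpotent thickenings of the affine line *)

Section Nilpotent.
Variable B : comPzRingType.

Lemma nilp_add (x y : B) m l : x ^+ m = 0 -> y ^+ l = 0 -> (x + y) ^+ (m + l) = 0.
Proof.
move=> xm yl; rewrite exprDn big1 // => -[i /= ile] _.
case: (leqP l i) => [li|il].
  by rewrite -(subnK li) exprD yl !mulr0 mul0rn.
have mi : (m <= m + l - i)%N by rewrite -addnBA ?leq_addr // ltnW.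
by rewrite -(subnK mi) exprD xm mulr0 mul0r mul0rn.
Qed.

Lemma invertible_mul (a b : B) : invertible a -> invertible b -> invertible (a * b).
Proof. by move=> [c h] [d h']; exists (c * d); rewrite mulrACA h h' mulr1. Qed.

Lemma invertible_nilp (u x : B) m : invertible u -> x ^+ m = 0 -> invertible (u - x).
Proof.
move=> [c h] xm; have ym : (x * c) ^+ m = 0 by rewrite exprMn xm mul0r.
apply: (@invertible_factor _ (u - x) c); rewrite mulrBl h.
exists (\sum_(i < m) (x * c) ^+ i).
have := subrXX 1 (x * c) m; rewrite expr1n ym subr0 => e; rewrite [RHS]e; congr (_ * _).
by apply: eq_bigr => i _; rewrite expr1n mul1r.
Qed.

End Nilpotent.

Lemma nilp_not_invertible (B : comNzRingType) (x : B) m :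
  x ^+ m = 0 -> ~ invertible x.
Proof.
move=> xm [c h]; have : (x * c) ^+ m = 1 by rewrite h expr1n.
by rewrite exprMn xm mul0r => /esym/eqP; rewrite oner_eq0.
Qed.

(** * Polynomials over an algebraically closed field of characteristic zero *)

Section Poly.
Variable k : numClosedFieldType.
Implicit Types p q f h : {poly k}.

(** In characteristic zero the integers 0, 1, ..., deg p are already too many roots. *)
Lemma poly_eq0_everywhere p : (forall z, p.[z] = 0) -> p = 0.
Proof.
move=> H; apply: contrapT => /eqP p0.
have all_roots : all (root p) [seq i%:R | i <- iota 0 (size p)].
  by apply/allP => x _; apply/rootP.
have := max_poly_roots p0 all_roots; rewrite size_map size_iota ltnn => H'; suff: false by [].
by apply: H'; rewrite map_inj_uniq ?iota_uniq // => i j /eqP; rewrite eqr_nat => /eqP.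
Qed.

Lemma poly_eq0_generic h p : h != 0 -> (forall z, h.[z] != 0 -> p.[z] = 0) -> p = 0.
Proof.
move=> h0 H; have : h * p = 0.
  apply: poly_eq0_everywhere => z; rewrite hornerM.
  by have [->|/H ->] := eqVneq h.[z] 0; rewrite ?mul0r ?mulr0.
by move/eqP; rewrite mulf_eq0 (negPf h0) => /eqP.
Qed.

(** After multiplication by X^(size q) both sides become polynomials that agree off 0, and
    coefficients can be compared. Regularity at infinity enters in this form: m = 0 is the case of
    functions on the projective line, m = 2 that of vector fields. *)
Lemma poly_reverse p q m : (forall z, z != 0 -> p.[z] = z ^+ m * q.[z^-1]) ->
  forall j, p`_j = if (j <= m)%N then q`_(m - j) else 0.
Proof.
move=> H j.
have E : 'X^(size q) * p = \sum_(i < size q) q`_i *: 'X^(m + size q - i).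
  apply/eqP; rewrite -subr_eq0; apply/eqP; apply: (@poly_eq0_generic 'X).
    by rewrite polyX_eq0.
  move=> z; rewrite hornerX => z0; apply/eqP; rewrite hornerD hornerN subr_eq0; apply/eqP.
  have aux N i : (i <= N)%N -> z ^+ N * z^-1 ^+ i = z ^+ (N - i).
    by move=> h; rewrite -{1}(subnK h) exprD -mulrA -exprMn mulfV // expr1n mulr1.
  rewrite hornerM hornerXn H // horner_sum mulrCA horner_coef !mulr_sumr.
  apply: eq_bigr => i _; rewrite hornerZ hornerXn.
  have il : (i <= size q)%N by apply: ltnW.
  rewrite -addnBA // exprD -(aux _ _ il); ring.
have := congr1 (fun r : {poly k} => r`_(size q + j)) E.
rewrite /= coefXnM ltnNge leq_addr /= addKn => ->; rewrite coef_sum.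
transitivity (\sum_(i < size q) (if (i + j == m)%N then q`_i else 0)).
  apply: eq_bigr => i _; rewrite coefZ coefXn.
  have il : (i < size q)%N by [].
  have -> : (size q + j == m + size q - i)%N = (i + j == m)%N by apply/eqP/eqP; lia.
  by case: ifP; rewrite ?mulr1 ?mulr0.
case: leqP => jm.
  have [lt|ge] := ltnP (m - j) (size q).
    rewrite (bigD1 (Ordinal lt)) //= subnK // eqxx big1 ?addr0 // => i ne.
    case: eqP => // e; case/eqP: ne; apply: val_inj => /=; lia.
  rewrite nth_default // big1 // => i _; case: eqP => // e.
  have il : (i < size q)%N by []. lia.
rewrite big1 // => i _; case: eqP => // e; lia.
Qed.

Lemma poly_bezout (r : nat) (q : 'I_r -> {poly k}) :
  exists (c : 'I_r -> {poly k}) (d : {poly k}),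
    \sum_(i < r) c i * q i = d /\ forall i, d %| q i.
Proof.
elim: r q => [|r IH] q.
  by exists (fun=> 0), 0; split; [rewrite big_ord0|case].
have [c [d [cd dq]]] := IH (fun i => q (lift ord0 i)).
have [[u v] /= uv] := Bezoutp (q ord0) d.
exists (fun i => if unlift ord0 i is Some j then v * c j else u).
exists (u * q ord0 + v * d); split.
  rewrite big_ord_recl unlift_none; congr (_ + _); rewrite -cd mulr_sumr.
  by apply: eq_bigr => i _; rewrite liftK mulrA.
move=> i; rewrite (eqp_dvdl _ uv); case: (unliftP ord0 i) => [j ->|->].
  exact: dvdp_trans (dvdp_gcdr _ _) (dq j).
exact: dvdp_gcdl.
Qed.

(** Nullstellensatz in one variable: a generator of the ideal has no root, hence is a nonzero
    constant. *)
Lemma poly_unit_ideal (r : nat) (q : 'I_r -> {poly k}) :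
  (forall z, exists i, (q i).[z] != 0) -> exists c : 'I_r -> {poly k}, \sum_(i < r) c i * q i = 1.
Proof.
move=> H; have [c [d [cd dq]]] := poly_bezout q.
have /size_poly1P[a a0 da] : size d == 1.
  apply: contraT => /closed_rootP [z /rootP dz]; have [i0] := H z.
  by rewrite -(divpK (dq i0)) hornerM dz mulr0 eqxx.
exists (fun i => a^-1 *: c i).
transitivity (a^-1 *: \sum_(i < r) c i * q i).
  by rewrite scaler_sumr; apply: eq_bigr => i _; rewrite scalerAl.
by rewrite cd da -mul_polyC -polyCM mulVf.
Qed.

(** The other form of the Nullstellensatz: the roots of [q] are split off one at a time, each being
    a root of [f] and costing one more factor [f]. *)
Lemma dvdp_pow_roots f q : q != 0 -> (forall z, f.[z] != 0 -> q.[z] != 0) ->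
  exists m, q %| f ^+ m.
Proof.
have [s] := ubnP (size q); elim: s q => // s IH q; rewrite ltnS => qs q0 H.
case: (boolP (size q == 1)) => [|/closed_rootP [z qz]].
  by rewrite size_poly_eq1 => /eqp_dvdl h; exists 0%N; rewrite expr0 h dvd1p.
have fz : root f z by apply/rootP/eqP; apply: contraT => /H; rewrite (rootP qz) eqxx.
have [q1 e] := factor_theorem _ _ qz; have [g ef] := factor_theorem _ _ fz.
have q10 : q1 != 0 by apply: contraNneq q0 => h; rewrite e h mul0r.
have [|//|y /H|m hm] := IH q1.
- move: qs; rewrite e size_Mmonic ?monicXsubC // size_XsubC addn2 /=. lia.
- by rewrite e hornerM mulf_eq0 negb_or => /andP[].
exists m.+1; rewrite exprSr {2}ef e mulrA dvdp_mul //.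
exact: dvdp_mulr.
Qed.
End Poly.

(** * Morphisms between the test algebras *)

Section Functoriality.
Variable k : fieldType.

Section Co0.
Variable B : comAlgType k.
Lemma co0_linear : linear (@co0 k B : trunc3 B -> B). Proof. by []. Qed.
HB.instance Definition _ :=
  GRing.isLinear.Build k (trunc3 B) B *:%R (@co0 k B : trunc3 B -> B) co0_linear.
Lemma co0_mult : monoid_morphism (@co0 k B : trunc3 B -> B). Proof. by []. Qed.
HB.instance Definition _ :=
  GRing.isMonoidMorphism.Build (trunc3 B) B (@co0 k B : trunc3 B -> B) co0_mult.
Definition co0m : {lrmorphism trunc3 B -> B} := (@co0 k B : trunc3 B -> B).
End Co0.

Section Map3.
Variables (B C : comAlgType k) (phi : {lrmorphism B -> C}).
Definition map3 (x : trunc3 B) : trunc3 C := mk3 (phi (co0 x)) (phi (co1 x)) (phi (co2 x)).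
Lemma map3_linear : linear map3.
Proof. by move=> a x y; apply: eq3; rewrite !co3E linearP. Qed.
HB.instance Definition _ := GRing.isLinear.Build k (trunc3 B) (trunc3 C) *:%R map3 map3_linear.
Lemma map3_mult : monoid_morphism map3.
Proof.
split; first by apply: eq3; rewrite !co3E ?rmorph0 ?rmorph1.
by move=> x y; apply: eq3; rewrite !co3E ?(rmorphD, rmorphM).
Qed.
HB.instance Definition _ := GRing.isMonoidMorphism.Build (trunc3 B) (trunc3 C) map3 map3_mult.
Definition map3m : {lrmorphism trunc3 B -> trunc3 C} := map3.
Lemma co0_map3 x : co0 (map3m x) = phi (co0 x). Proof. by []. Qed.
Lemma co1_map3 x : co1 (map3m x) = phi (co1 x). Proof. by []. Qed.
Lemma co2_map3 x : co2 (map3m x) = phi (co2 x). Proof. by []. Qed.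
Definition map3E := (co0_map3, co1_map3, co2_map3).
End Map3.

Lemma rmorph_nilp (A B : comAlgType k) (phi : {lrmorphism A -> B}) (x : A) m :
  x ^+ m = 0 -> phi x ^+ m = 0.
Proof. by move=> h; rewrite -rmorphXn h rmorph0. Qed.

Section Scal.
Variable A : comAlgType k.
Definition scal_fun (c : k^o) : A := (c : k)%:A.
Lemma scal_linear : linear scal_fun.
Proof. by move=> c p q; rewrite /scal_fun scalerDl scalerA. Qed.
HB.instance Definition _ := GRing.isLinear.Build k k^o A *:%R scal_fun scal_linear.
Lemma scal_mult : monoid_morphism scal_fun.
Proof. by split=> [|p q]; rewrite /scal_fun ?scale1r // -scalerAl mul1r scalerA. Qed.
HB.instance Definition _ := GRing.isMonoidMorphism.Build k^o A scal_fun scal_mult.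
Definition scal : {lrmorphism k^o -> A} := scal_fun.
End Scal.

Section Pev.
Variables (A : comAlgType k) (a : A).
Definition pev_fun (p : {poly k}) : A := horner_alg a p.
Lemma pev_linear : linear pev_fun.
Proof. by move=> c p q; rewrite /pev_fun linearP /= mulr_algl. Qed.
HB.instance Definition _ := GRing.isLinear.Build k {poly k} A *:%R pev_fun pev_linear.
Lemma pev_mult : monoid_morphism pev_fun.
Proof. by split=> [|p q]; rewrite /pev_fun ?rmorph1 ?rmorphM. Qed.
HB.instance Definition _ := GRing.isMonoidMorphism.Build {poly k} A pev_fun pev_mult.
Definition pev : {lrmorphism {poly k} -> A} := pev_fun.
End Pev.

Lemma pevX (A : comAlgType k) (a : A) : pev a 'X = a.
Proof. exact: horner_algX. Qed.

Lemma pevC (A : comAlgType k) (a : A) c : pev a c%:P = c%:A.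
Proof. exact: horner_algC. Qed.

Lemma pev_regular (z : k) p : pev (z : k^o) p = p.[z].
Proof.
elim/poly_ind: p => [|p c IH]; first by rewrite rmorph0 horner0.
rewrite rmorphD rmorphM /= IH pevX pevC hornerMXaddC; congr (_ + _).
exact: mulr1.
Qed.

Lemma pev_taylor (A : comAlgType k) (a h : A) p : h ^+ 2 = 0 ->
  pev (a + h) p = pev a p + pev a p^`() * h.
Proof.
move=> h2; elim/poly_ind: p => [|p c IH].
  by rewrite deriv0 !rmorph0 mul0r addr0.
rewrite derivMXaddC !(rmorphD, rmorphM) /= IH !pevX !pevC; ring: h2.
Qed.
End Functoriality.

(** * Thickenings of the affine line and descent on them *)

Section Thick.
Variable k : numClosedFieldType.

(* A nilpotent thickening [tA] of the affine line, with its fibre [tE], a local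
   algebra, over the points [z] of the line. *)
Record thick := Thick {
  tA : comAlgType k;
  tE : comAlgType k;
  tres : {lrmorphism tA -> {poly k}};
  tresE : {lrmorphism tE -> k^o};
  tev : k -> {lrmorphism tA -> tE};
  tconst : {lrmorphism tE -> tA};
  tsec : {lrmorphism {poly k} -> tA};
  tev_const : forall z e, tev z (tconst e) = e;
  tres_sec : forall p, tres (tsec p) = p;
  tres_nil : forall a, tres a = 0 -> exists m, a ^+ m = 0;
  tresE_nil : forall e, tresE e = 0 -> exists m, e ^+ m = 0;
  tev_res : forall z a, tresE (tev z a) = (tres a).[z];
  tev_detect : forall (h : {poly k}) a, h != 0 ->
    (forall z, h.[z] != 0 -> tev z a = 0) -> a = 0;
  tev_secX : forall z, tev z (tsec 'X) = z%:A;
  tuniv : forall (B : comAlgType k) (phi : {lrmorphism tE -> B}) (v : B),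
    exists psi : {lrmorphism tA -> B}, (forall e, psi (tconst e) = phi e) /\ psi (tsec 'X) = v;
  tev_inv_const : forall a b, (forall z, z != 0 -> tev z a = tev z^-1 b) ->
    exists e, a = tconst e }.

Lemma polyC_algE (c : k) : scal {poly k} c = c%:P. Proof. exact: alg_polyC. Qed.

(** The reduced case, k[v] over k. Here [tev_inv_const] is the fact that a polynomial in v that is
    also a polynomial in 1/v is constant. *)
Definition thick0 : thick.
Proof.
refine (@Thick {poly k} k^o idfun idfun (fun z => pev (z : k^o)) (scal _) idfun _ _ _ _ _ _ _ _ _).
- by move=> z e; rewrite polyC_algE pev_regular hornerC.
- by [].
- by move=> a /= ->; exists 1%N.
- by move=> a /= ->; exists 1%N.
- by move=> z a; rewrite /= pev_regular.
- move=> h a h0 H; apply: poly_eq0_generic h0 _ => z /H; by rewrite pev_regular.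
- by move=> z; rewrite pevX; exact/esym/mulr1.
- move=> B phi v; exists (pev v); split; last exact: pevX.
  move=> e; rewrite polyC_algE pevC -(rmorph_alg phi); congr (phi _); exact: mulr1.
- move=> a b H; exists (b`_0); rewrite polyC_algE; apply/polyP => j.
  have := @poly_reverse k a b 0; rewrite coefC => -> //.
    by case: j.
  by move=> z z0; rewrite mul1r; have := H z z0; rewrite !pev_regular.
Defined.

Lemma trunc3_nil (B : comAlgType k) (x : trunc3 B) m : co0 x ^+ m = 0 -> x ^+ (m + 3) = 0.
Proof.
move=> h; have -> : x = cst3 (co0 x) + mk3 0 (co1 x) (co2 x).
  by apply: eq3; rewrite !co3E ?add0r ?addr0.
apply: nilp_add; first by rewrite -(rmorphXn (cst3m B)) h rmorph0.
by rewrite !exprS expr0; apply: eq3; rewrite !co3E; ring.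
Qed.

(** Adjoins a cube-zero parameter both to the functions and to the fibre. Iterated from [thick0] it
    gives E[v] over E, where E is generated over k by several cube-zero parameters; equalities are
    inherited coefficient by coefficient. *)
Definition thickS (T : thick) : thick.
Proof.
refine (@Thick (trunc3 (tA T)) (trunc3 (tE T)) (tres T \o co0m (tA T)) (tresE T \o co0m (tE T))
  (fun z => map3m (tev T z)) (map3m (tconst T)) (cst3m (tA T) \o tsec T) _ _ _ _ _ _ _ _ _).
- by move=> z e; apply: eq3; rewrite !map3E tev_const.
- move=> p; exact: tres_sec.
- by move=> a /tres_nil[m h]; exists (m + 3)%N; exact: trunc3_nil.
- by move=> a /tresE_nil[m h]; exists (m + 3)%N; exact: trunc3_nil.
- move=> z a; exact: tev_res.
- move=> h a h0 H; apply: eq3; apply: (@tev_detect T h) => // z /H.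
  + by move/(congr1 (@co0 _ _)); rewrite !(map3E, co3E).
  + by move/(congr1 (@co1 _ _)); rewrite !(map3E, co3E).
  + by move/(congr1 (@co2 _ _)); rewrite !(map3E, co3E).
- by move=> z; rewrite -[RHS](rmorph_alg (cst3m (tE T))) /= -(tev_secX T z);
    apply: eq3; rewrite map3E !co3E ?rmorph0.
- move=> B phi v; have [psi [h1 h2]] := @tuniv T B (phi \o cst3m (tE T)) v.
  have g3 : (phi gen3) ^+ 3 = 0 by apply: rmorph_nilp; exact: gen3_cube.
  exists (liftm psi g3 : {lrmorphism trunc3 (tA T) -> B}); split; last first.
    by rewrite /= /liftm /lift3 !co3E !rmorph0 !mul0r !addr0.
  move=> e; rewrite /= /liftm /lift3 !map3E !h1 /=.
  rewrite -!rmorphM -!rmorphXn -!rmorphM -!rmorphD; congr (phi _).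
  by rewrite expr2; apply: eq3; rewrite !co3E; ring.
- move=> a b H.
  have [|e0 h0] := @tev_inv_const T (co0 a) (co0 b).
    by move=> z /H /(congr1 (@co0 _ _)); rewrite !(map3E, co3E).
  have [|e1 h1] := @tev_inv_const T (co1 a) (co1 b).
    by move=> z /H /(congr1 (@co1 _ _)); rewrite !(map3E, co3E).
  have [|e2 h2] := @tev_inv_const T (co2 a) (co2 b).
    by move=> z /H /(congr1 (@co2 _ _)); rewrite !(map3E, co3E).
  by exists (mk3 e0 e1 e2); apply: eq3; rewrite !(map3E, co3E).
Defined.

Section ThickTheory.
Variable T : thick.

Lemma tres_unit a : tres T a = 1 -> invertible a.
Proof.
move=> h; have [m hm] : exists m, (1 - a) ^+ m = 0.
  by apply: tres_nil; rewrite rmorphB rmorph1 /= h subrr.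
have -> : a = 1 - (1 - a) by ring.
by apply: invertible_nilp hm; exists 1; rewrite mulr1.
Qed.

Lemma tE_unit e : tresE T e != 0 -> invertible e.
Proof.
set c := tresE T e => c0.
have [m hm] : exists m, (1 - c^-1 *: e) ^+ m = 0.
  apply: tresE_nil; rewrite rmorphB rmorph1 /= linearZ /= -/c.
  by rewrite -[_ *: _]/(c^-1 * c) mulVf // subrr.
have : invertible (1 - (1 - c^-1 *: e)).
  by apply: invertible_nilp hm; exists 1; rewrite mulr1.
have -> : 1 - (1 - c^-1 *: e) = e * c^-1%:A.
  by rewrite mulr_algr; ring.
exact: invertible_factor.
Qed.

Lemma tE_local : local_alg (tE T).
Proof.
move=> a; have [h|h] := eqVneq (tresE T a) 0; [right|left]; apply: tE_unit => //.
by rewrite rmorphB rmorph1 /= h subr0 oner_neq0.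
Qed.

(* Zariski descent for functions on the thickened line, given on the cover by
   the opens [f i <> 0] as the fractions [n i / q i]. *)
Lemma thick_descent (r : nat) (f e n q : 'I_r -> tA T) :
  \sum_(i < r) e i * f i = 1 ->
  (forall i z, (tres T (f i)).[z] != 0 -> (tres T (q i)).[z] != 0) ->
  (forall i j z, (tres T (f i)).[z] != 0 -> (tres T (f j)).[z] != 0 ->
     tev T z (n i * q j) = tev T z (n j * q i)) ->
  exists V, forall i (B : comAlgType k) (phi : {lrmorphism tA T -> B}),
    invertible (phi (f i)) -> phi (n i) = phi (q i) * phi V /\ invertible (phi (q i)).
Proof.
move=> ef H1 H2.
(* If [f i] vanishes on the whole line, the open set it defines is empty and nothing controls the
   fraction there, which is therefore replaced by 0/0. *)
pose n' i := if tres T (f i) == 0 then 0 else n i.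
pose q' i := if tres T (f i) == 0 then 0 else q i.
have comp i j : n' i * q' j = n' j * q' i.
  rewrite /n' /q'; case: eqP => [|/eqP fi]; first by rewrite mul0r mulr0.
  case: eqP => [|/eqP fj]; first by rewrite mul0r mulr0.
  apply/eqP; rewrite -subr_eq0; apply/eqP.
  apply: (@tev_detect T (tres T (f i) * tres T (f j))); first by rewrite mulf_neq0.
  move=> z; rewrite hornerM mulf_eq0 negb_or => /andP[zi zj].
  by rewrite rmorphB /= (H2 i j) // subrr.
(* The denominators have no common zero, since at each point some [f i] is nonzero. A combination of
   them is thus 1 modulo nilpotents, hence a unit. *)
have [|c cq] := @poly_unit_ideal k r (fun i => tres T (q' i)).
  move=> z; have : exists i, (tres T (f i)).[z] != 0.
    apply: contrapT => /forallNP H.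
    have := congr1 (fun a => (tres T a).[z]) ef.
    rewrite /= rmorph1 rmorph_sum horner_sum hornerC big1 => [/esym/eqP|i _].
      by rewrite oner_eq0.
    by rewrite rmorphM hornerM; have /negP := H i; rewrite negbK => /eqP ->; rewrite mulr0.
  move=> [i fi]; exists i; rewrite /q'; case: ifP => [/eqP h|_]; last exact: H1 fi.
  by rewrite h horner0 eqxx in fi.
have [u hu] : invertible (\sum_(i < r) tsec T (c i) * q' i).
  apply: tres_unit; rewrite rmorph_sum -cq; apply: eq_bigr => i _.
  by rewrite rmorphM /= tres_sec.
(* The same combination of the numerators, divided by that of the denominators; by [comp] its
   product with each denominator is the numerator. *)
exists (u * \sum_(i < r) tsec T (c i) * n' i) => i B phi fi.
have fi0 : tres T (f i) != 0.
  apply/eqP => /tres_nil[m hm]; apply: nilp_not_invertible fi.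
  exact: rmorph_nilp hm.
have qV : n' i = q' i * (u * \sum_(i < r) tsec T (c i) * n' i).
  rewrite mulrCA mulr_sumr.
  transitivity (u * \sum_(j < r) tsec T (c j) * q' j * n' i); last first.
    by congr (_ * _); apply: eq_bigr => j _; rewrite -mulrA [q' j * _]mulrC comp; ring.
  by rewrite -mulr_suml mulrA [u * _]mulrC hu mul1r.
move: qV; rewrite /n' /q' (negPf fi0) => qV; split.
  by rewrite -rmorphM [in LHS]qV.
have q0 : tres T (q i) != 0.
  apply/eqP => h; apply/negP: fi0; rewrite negbK; apply/eqP.
  apply: poly_eq0_everywhere => z; apply/eqP; apply: contraT => /H1.
  by rewrite h horner0 eqxx.
(* Modulo nilpotents [q i] divides a power of [f i], so it is invertible wherever [f i] is. *)
have [m /dvdpP [h hm]] := dvdp_pow_roots q0 (H1 i).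
have [l hl] : exists l, (f i ^+ m - q i * tsec T h) ^+ l = 0.
  by apply: tres_nil; rewrite rmorphB rmorphM rmorphXn /= hm tres_sec mulrC subrr.
apply: (@invertible_factor _ _ (phi (tsec T h))).
have -> : phi (q i) * phi (tsec T h) = phi (f i) ^+ m - phi (f i ^+ m - q i * tsec T h).
  by rewrite rmorphB rmorphXn rmorphM /=; ring.
apply: (@invertible_nilp _ _ _ l); last exact: rmorph_nilp hl.
have [b hb] := fi; exists (b ^+ m); by rewrite -exprMn hb expr1n.
Qed.
End ThickTheory.
End Thick.

(** * Global coordinates of a point over a thickened line *)

Lemma germ_fractions (k : fieldType) n (A : comAlgType k) (w : Wn k n A) :
  exists (r : nat) (f e : 'I_r -> A) (s : 'I_r -> bool) (a x y : 'I_r -> A) (m : 'I_r -> nat),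
    \sum_(i < r) e i * f i = 1 /\
    forall i (B : comAlgType k) (locB : local_alg B) (phi : {lrmorphism A -> B}) (b : B),
      phi (f i) * b = 1 ->
      unimod2 (phi (x i) * b ^+ m i) (phi (y i) * b ^+ m i) /\
      germ_of w locB phi =
        [set q | W_same (phi (W_pi (proj1_sig w)))
          (at_chart (s i) (phi (a i) * b ^+ m i) (phi (x i) * b ^+ m i) (phi (y i) * b ^+ m i)) q].
Proof.
have [r [f [e [ef H]]]] := germ_glued w; exists r, f, e.
have /choice [d Hd] : forall i, exists d : bool * (A * A * A) * nat,
  forall (B : comAlgType k) (locB : local_alg B) (phi : {lrmorphism A -> B}) (b : B),
      phi (f i) * b = 1 ->
      unimod2 (phi d.1.2.1.2 * b ^+ d.2) (phi d.1.2.2 * b ^+ d.2) /\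
      germ_of w locB phi =
        [set q | W_same (phi (W_pi (proj1_sig w)))
          (at_chart d.1.1 (phi d.1.2.1.1 * b ^+ d.2) (phi d.1.2.1.2 * b ^+ d.2)
             (phi d.1.2.2 * b ^+ d.2)) q].
  move=> i; have [p [m Hp]] := H i; have [s [a [x [y E]]]] := W_tupleP p.
  exists ((s, ((a, x), y)), m) => B locB phi b hb /=.
  have [sm gE] := Hp B locB phi b hb.
  have fE : frac_tuple phi b m p = at_chart s (phi a * b ^+ m) (phi x * b ^+ m) (phi y * b ^+ m).
    by rewrite E; case: (s).
  rewrite fE in sm gE; split; last exact: gE.
  by have := W_same_admissible sm; rewrite admissible_at.
exists (fun i => (d i).1.1), (fun i => (d i).1.2.1.1), (fun i => (d i).1.2.1.2),
  (fun i => (d i).1.2.2), (fun i => (d i).2); split=> //.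
Qed.

Lemma is_pt_germ (k : fieldType) n (A B : comAlgType k) (phi : {lrmorphism A -> B})
    (w : Wn k n A) t c (locB : local_alg B) :
  is_pt (base_change phi w) t c -> germ_of w locB phi c.
Proof.
move=> [_ adm /(_ B locB idfun)]; rewrite germ_bc.
have -> : (idfun \o phi : {lrmorphism A -> B}) = phi by exact: lrmorphism_eq.
move=> ->; have -> : cmap (idfun : {lrmorphism B -> B}) c = c by case: (c).
exact: W_same_refl.
Qed.

Lemma invertible_rmorphM (k : fieldType) (A B : comAlgType k) (phi : {lrmorphism A -> B}) a b :
  invertible (phi a) -> invertible (phi b) -> invertible (phi (a * b)).
Proof. by move=> ha hb; rewrite rmorphM; exact: invertible_mul. Qed.

Section Regularity.
Variables (k : numClosedFieldType) (n : nat) (T : thick k).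
Local Notation A := (tA T).

Definition tpt (z : k) : {lrmorphism A -> k^o} := tresE T \o tev T z.

Lemma local_field : local_alg (k^o : comAlgType k).
Proof.
move=> a; have [->|h] := eqVneq a 0; [right|left]; first by exists 1; rewrite subr0 mulr1.
by exists (a^-1 : k); exact: mulfV.
Qed.

Lemma field_invertible (a : k^o) : invertible a <-> a != 0.
Proof.
split=> [[b h]|h]; last by exists (a^-1 : k); exact: mulfV.
by apply/eqP => a0; move/eqP: h; rewrite a0 mul0r eq_sym oner_eq0.
Qed.

(** A coordinate is described by a functional relation [C] on local algebras. Over each z the local
    fractions are compared in the local algebra [tE T], where functionality makes them equal;
    descent then glues them. *)
Lemma regular_coordinate
    (C : forall B : comAlgType k, local_alg B -> {lrmorphism A -> B} -> B -> Prop)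
    (r : nat) (f e num q : 'I_r -> A) :
  (forall (B : comAlgType k) (locB : local_alg B) (phi : {lrmorphism A -> B}) (v v' : B),
     C B locB phi v -> C B locB phi v' -> v = v') ->
  \sum_(i < r) e i * f i = 1 ->
  (forall i z, tpt z (f i) != 0 -> tpt z (q i) != 0) ->
  (forall i (B : comAlgType k) (locB : local_alg B) (phi : {lrmorphism A -> B}) (v : B),
     invertible (phi (f i)) -> invertible (phi (q i)) ->
     phi (num i) = phi (q i) * v -> C B locB phi v) ->
  exists V, forall (B : comAlgType k) (locB : local_alg B) (phi : {lrmorphism A -> B}),
    C B locB phi (phi V).
Proof.
move=> Cfun ef H1 HC.
have unit_ev z (g : A) : tpt z g != 0 -> invertible (tev T z g) by exact: tE_unit.
have tptE z (g : A) : tpt z g = (tres T g).[z] by exact: tev_res.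
have [|i j z|V HV] := @thick_descent k T r f e num q ef; last 1 first.
- exists V => B locB phi.
  have [|i] := @local_sum k B locB r (fun i => phi (e i) * phi (f i)).
    exists 1; rewrite mulr1 -(rmorph1 phi) -ef rmorph_sum.
    by apply: eq_bigr => j _; rewrite rmorphM.
  rewrite mulrC => /invertible_factor fi; have [E qi] := HV i B phi fi.
  exact: HC fi qi E.
- by move=> i z; rewrite -!tptE; exact: H1.
rewrite -!tptE => fi fj.
have [u hu] := unit_ev z _ (H1 i z fi); have [u' hu'] := unit_ev z _ (H1 j z fj).
have E : tev T z (num i) * u = tev T z (num j) * u'.
  apply: (Cfun (tE T) (@tE_local k T) (tev T z)).
    by apply: (HC i) => //; [exact: unit_ev|exists u|rewrite mulrCA hu mulr1].
  by apply: (HC j) => //; [exact: unit_ev|exists u'|rewrite mulrCA hu' mulr1].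
rewrite !rmorphM /=.
have -> : tev T z (num i) * tev T z (q j) =
  (tev T z (num i) * u) * (tev T z (q i) * tev T z (q j)) by rewrite mulrACA [u * _]mulrC; ring: hu.
rewrite E.
ring: hu'.
Qed.

Variable w : Wn k n A.
Local Notation t := (W_pi (proj1_sig w)).

Lemma regular_v (b : bool) :
  (forall z, exists v x y, is_pt (base_change (tpt z) w) 0 (at_chart b v x y)) ->
  exists V, forall (B : comAlgType k) (locB : local_alg B) (phi : {lrmorphism A -> B}),
    exists x y, germ_of w locB phi (at_chart b (phi V) x y).
Proof.
move=> Hz; have [r [f [e [s [a [x [y [m [ef H]]]]]]]]] := germ_fractions w.
pose C (B : comAlgType k) (locB : local_alg B) (phi : {lrmorphism A -> B}) (v : B) :=
  exists x y, germ_of w locB phi (at_chart b v x y).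
(* The coordinate v is a / f^m on the pieces given in the chart [b], and f^m / a on the others
   because v v' = 1. There [a] does not vanish at the points of the piece, since these points lie in
   the chart [b]. *)
apply: (@regular_coordinate C r f e (fun i => if s i == b then a i else f i ^+ m i)
   (fun i => if s i == b then f i ^+ m i else a i)) ef _ _.
- move=> B locB phi v v' [x1 [y1]] + [x2 [y2]].
  have [d [_ ->]] := germ_local w locB phi => /= h1 h2.
  by have := W_same_trans (W_same_sym h1) h2; rewrite W_same_eq => -[].
- move=> i z fi; case: ifP => sb.
    by rewrite rmorphXn expf_neq0.
  have [v [x1 [y1 /(is_pt_germ local_field)]]] := Hz z.
  have fb : tpt z (f i) * ((tpt z (f i) : k)^-1 : k) = 1 by exact: mulfV.
  have [_ ->] := H i _ local_field (tpt z) _ fb => /=.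
  have -> : b = ~~ s i by move: sb; case: (s i) (b) => [] [].
  rewrite W_same_neq => -[vv _]; apply/field_invertible.
  by apply: invertible_factor; exists v; exact: vv.
- move=> i B locB phi v [c hc] qi E.
  have [U gE] := H i B locB phi c hc; rewrite /C gE /=.
  case: ifP E qi => [/eqP -> E _|sb E qi].
    have -> : v = phi (a i) * c ^+ m i.
      rewrite E rmorphXn mulrAC -exprMn hc expr1n mul1r //.
    exists (phi (x i) * c ^+ m i), (phi (y i) * c ^+ m i).
    by rewrite W_same_eq; split=> //; exact: peq_refl.
  have -> : b = ~~ s i by move: sb; case: (s i) (b) => [] [].
  have vv : (phi (a i) * c ^+ m i) * v = 1.
    by rewrite mulrAC -E rmorphXn -exprMn hc expr1n.
  do 2!eexists; rewrite W_same_neq; split; first exact: vv.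
  exact: peq_refl (proj1 (peq_glue _ vv (peq_refl U))).
Qed.

Lemma fraction_key (B D : comAlgType k) (phi : {lrmorphism B -> D}) (s : bool)
    (tt f a x y : B) (c : D) m : phi f * c = 1 ->
  phi (y * a ^+ 2 - sgn s tt * a * x * f ^+ m) * (c ^+ m * c ^+ m * c ^+ m) =
  phi y * c ^+ m * (phi a * c ^+ m) ^+ 2 - sgn s (phi tt) * (phi a * c ^+ m) * (phi x * c ^+ m).
Proof.
move=> fc; have fm : phi f ^+ m * c ^+ m = 1 by rewrite -exprMn fc expr1n.
have -> : sgn s (phi tt) = phi (sgn s tt) by case: s; rewrite //= rmorphN.
rewrite !(rmorphB, rmorphXn, rmorphM) /=; ring: fm.
Qed.

Lemma regular_pt (b : bool) :
  (forall z, exists v p, is_pt (base_change (tpt z) w) 0 (at_chart b v p 1)) ->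
  exists V P, is_pt w t (at_chart b V P 1).
Proof.
move=> Hz; have [|V HV] := @regular_v b.
  by move=> z; have [v [p h]] := Hz z; exists v, p, 1.
have [r [f [e [s [a [x [y [m [ef H]]]]]]]]] := germ_fractions w.
pose C (B : comAlgType k) (locB : local_alg B) (phi : {lrmorphism A -> B}) (p : B) :=
  exists v, germ_of w locB phi (at_chart b v p 1).
(* For a piece given in the other chart, the transition turns entries over f^m into the second
   coordinate (y a^2 - t a x f^m) / f^(3m), up to the sign of t; hence p = x f^(2m) / (y a^2 - t a x
   f^m). The extra factor [a] in numerator and denominator ensures that the piece lies in the
   overlap wherever [q i] is invertible. *)
pose q i := if s i == b then y i
  else a i * (y i * a i ^+ 2 - sgn (s i) t * a i * x i * f i ^+ m i).
pose num i := if s i == b then x i else a i * x i * f i ^+ (m i * 2).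
have [] := @regular_coordinate C r f e num q _ ef _ _.
- move=> B locB phi p p' [v1] + [v2].
  have [d [_ ->]] := germ_local w locB phi => /= h1 h2.
  have := W_same_trans (W_same_sym h1) h2; rewrite W_same_eq => -[_ [_ [l [l' [_ [-> e1]]]]]].
  by rewrite -[LHS]mul1r e1 mulr1.
- move=> i z fi; have [v [p /(is_pt_germ local_field)]] := Hz z.
  pose c : k^o := (tpt z (f i) : k)^-1.
  have fb : tpt z (f i) * c = 1 by exact: mulfV.
  have [_ ->] := H i _ local_field (tpt z) c fb => /=.
  rewrite /q; case: ifP => [/eqP ->|sb].
    rewrite W_same_eq => -[_ [_ [l [l' [_ [_ yl]]]]]]; apply/field_invertible.
    by apply: (@invertible_factor _ _ (c ^+ m i)); exists l; rewrite mulrC; exact: esym yl.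
  have -> : b = ~~ s i by move: sb; case: (s i) (b) => [] [].
  rewrite W_same_neq => -[vv [_ [l [l' [_ [_ yl]]]]]]; apply/field_invertible.
  apply: (@invertible_rmorphM _ _ _ (tpt z)).
    by apply: invertible_factor; exists v; exact: vv.
  apply: (@invertible_factor _ _ (c ^+ m i * c ^+ m i * c ^+ m i)).
  exists l; rewrite mulrC; apply: etrans (esym yl); congr (_ * _); exact: fraction_key fb.
- move=> i B locB phi p [c hc] qi E.
  have [U gE] := H i B locB phi c hc; rewrite /C gE /=.
  move: E qi; rewrite /num /q; case: ifP => [/eqP -> E [l hl]|sb E qi].
    have yc : phi (y i) * c ^+ m i * (phi (f i) ^+ m i * l) = 1.
      transitivity ((phi (y i) * l) * (phi (f i) ^+ m i * c ^+ m i)); first by ring.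
      by rewrite hl -exprMn hc expr1n mulr1.
    exists (phi (a i) * c ^+ m i); rewrite W_same_eq; split=> //; split=> //.
    exists (phi (f i) ^+ m i * l), (phi (y i) * c ^+ m i); split; first by rewrite mulrC.
    split; last by rewrite mulrC yc.
    rewrite E -[LHS]mul1r -yc; ring.
  have -> : b = ~~ s i by move: sb; case: (s i) (b) => [] [].
  move: qi E; set Y := (y i * _ - _); rewrite !(rmorphM _ (a i * _)) !(rmorphM _ (a i)) => qi E.
  have [a' ha] := invertible_factor qi.
  move: qi; rewrite mulrC => /invertible_factor[Y' hY].
  have fm : phi (f i) ^+ m i * c ^+ m i = 1 by rewrite -exprMn hc expr1n.
  have xE : phi (x i) * phi (f i ^+ (m i * 2)) = phi Y * p.
    transitivity (a' * (phi (a i) * phi (x i) * phi (f i ^+ (m i * 2)))).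
      by rewrite !mulrA [a' * _]mulrC ha mul1r.
    by rewrite E !mulrA [a' * _]mulrC ha mul1r.
  pose Q := phi Y * (c ^+ m i * c ^+ m i * c ^+ m i).
  have QE : Q = _ := fraction_key (s i) t (a i) (x i) (y i) (m i) hc.
  exists (a' * phi (f i) ^+ m i); rewrite W_same_neq.
  have vv : phi (a i) * c ^+ m i * (a' * phi (f i) ^+ m i) = 1.
    transitivity ((phi (a i) * a') * (phi (f i) ^+ m i * c ^+ m i)); first by ring.
    by rewrite ha fm mulr1.
  have QQ : Y' * phi (f i) ^+ m i ^+ 3 * Q = 1.
    transitivity ((phi Y * Y') * (phi (f i) ^+ m i * c ^+ m i) ^+ 3); first by rewrite /Q; ring.
    by rewrite hY fm expr1n mulr1.
  split=> //; rewrite -QE; split.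
    by exists 0, (Y' * phi (f i) ^+ m i ^+ 3); rewrite mul0r add0r.
  exists (Y' * phi (f i) ^+ m i ^+ 3), Q; do 2!split=> //.
  transitivity (Y' * (phi (x i) * phi (f i ^+ (m i * 2))) * (phi (f i) ^+ m i * c ^+ m i)).
    by rewrite xE fm mulr1 mulrA [Y' * _]mulrC hY mul1r.
  by rewrite rmorphXn exprM; ring.
move=> P HP; exists V, P; apply: is_pt_intro => //.
  by rewrite admissible_at; exists 0, 1; rewrite mul0r add0r mulr1.
move=> B locB phi; have [x1 [y1 h1]] := HV B locB phi; have [v1 h2] := HP B locB phi.
have [d [_ gd]] := germ_local w locB phi.
have E : W_same (phi t) (at_chart b (phi V) x1 y1) (at_chart b v1 (phi P) 1).
  by move: h1 h2; rewrite gd /= => h1 h2; exact: W_same_trans (W_same_sym h1) h2.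
move: E; rewrite W_same_eq => -[Ev _]; rewrite {}Ev in h2.
exists (at_chart b (phi V) (phi P) 1); split=> //.
have -> : cmap phi (at_chart b V P 1) = at_chart b (phi V) (phi P) 1.
  by case: (b); rewrite /= rmorph1.
by rewrite W_same_eq; split=> //; apply: peq_refl; exists 0, 1; rewrite mul0r add0r mulr1.
Qed.
End Regularity.

(** * The shape of the lifted action *)

Lemma at_chart_map (A B : comPzRingType) (phi : A -> B) b v x y :
  cmap phi (at_chart b v x y) = at_chart b (phi v) (phi x) (phi y).
Proof. by case: b. Qed.

(** The algebra [tA T] is not local, so coordinates are compared in the local algebra over each z,
    and these comparisons together detect equality. *)
Lemma is_pt_inj_thick (k : numClosedFieldType) n (T : thick k) (w : Wn k n (tA T))
    t t' b v v' p p' :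
  is_pt w t (at_chart b v p 1) -> is_pt w t' (at_chart b v' p' 1) ->
  [/\ t = t', v = v' & p = p'].
Proof.
move=> h h'.
have [] : t = t' /\ forall z, tev T z v = tev T z v' /\ tev T z p = tev T z p'.
  split; first by case: h => <- _ _; case: h'.
  move=> z; have := is_pt_bc (tev T z) h; have := is_pt_bc (tev T z) h'.
  rewrite !at_chart_map !rmorph1 => e' e.
  have [_] := is_pt_inj (@tE_local k T) e e'.
  by rewrite W_same_eq => -[-> [_ [l [l' [_ [-> e1]]]]]]; split=> //; rewrite -[LHS]mul1r e1 mulr1.
move=> -> H; split=> //; apply/eqP; rewrite -subr_eq0; apply/eqP;
  apply: (@tev_detect k T 1) => [|z _]; rewrite ?oner_neq0 // rmorphB /=;
  have [e1 e2] := H z; by rewrite ?e1 ?e2 subrr.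
Qed.

Section Action.
Variables (k : numClosedFieldType).
Variable alpha : algebraic_action (Aut (F2 k)) (Wn k 2).
Variable beta : algebraic_action (Aut (F2 k)) (base k 2).
Hypothesis Hpi : pi_equivariant alpha beta.
Hypothesis Hf : f_equivariant (tautological_action (F2 k)) alpha.
Local Notation G := (Aut (F2 k)).

Lemma act_base (A : comAlgType k) (g : G A) (w w' : Wn k 2 A) :
  W_pi (proj1_sig w) = W_pi (proj1_sig w') ->
  W_pi (proj1_sig (alpha A g w)) = W_pi (proj1_sig (alpha A g w')).
Proof.
move=> e; have := congr1 (@proj1_sig _ _) (Hpi g w); have := congr1 (@proj1_sig _ _) (Hpi g w').
rewrite /= => -> ->; congr (proj1_sig (beta A g _)); exact: sig_eq.
Qed.

Lemma act_bc (A B : comAlgType k) (phi : {lrmorphism A -> B}) (g : G A) (w : Wn k 2 A) :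
  base_change phi (alpha A g w) = alpha B (base_change phi g) (base_change phi w).
Proof. exact: act_nat. Qed.

Lemma unimod_pt (A : comPzRingType) (x : A) : unimod2 x 1.
Proof. by exists 0, 1; rewrite mul0r add0r mulr1. Qed.

Lemma field_nilp (t : k^o) n : t ^+ n = 0 -> t = 0.
Proof. by move/eqP; rewrite (@expf_eq0 k) => /andP[_ /eqP]. Qed.

(* The fibres of the family over the v-line are projective lines, on which a
   function is constant. *)
Lemma fibre_constant (T : thick k) (g : G (tE T)) (t v0 : tE T) (b b' : bool) :
  t ^+ 3 = 0 ->
  (forall x y (w : Wn k 2 k^o), is_pt w 0 (at_chart b (tresE T v0) x y) ->
     exists v1 x1 y1, is_pt (alpha k^o (base_change (tresE T) g) w) 0 (at_chart b' v1 x1 y1)) ->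
  exists V : tE T, forall (B : comAlgType k) (locB : local_alg B)
      (phi : {lrmorphism tE T -> B}) (p : B) (w : Wn k 2 B),
    is_pt w (phi t) (at_chart b (phi v0) p 1) ->
    exists x y, germ_of (alpha B (base_change phi g) w) locB (idfun : {lrmorphism B -> B})
      (at_chart b' (phi V) x y).
Proof.
move=> t3 Hk.
have tres0 : tresE T t = 0 by apply: (@field_nilp _ 3); exact: rmorph_nilp.
have tc3 : tconst T t ^+ 3 = 0 by exact: rmorph_nilp.
(* The thickened line is here an affine chart of the fibre over [v0], and not the v-line: [X:1] and
   [1:X] run through the two charts of the fibre. *)
have [w1 w1P] : exists w1 : Wn k 2 (tA T),
  is_pt w1 (tconst T t) (at_chart b (tconst T v0) (tsec T 'X) 1).
  by apply: is_pt_exists => //; rewrite admissible_at; exact: unimod_pt.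
have [w2 w2P] : exists w2 : Wn k 2 (tA T),
  is_pt w2 (tconst T t) (at_chart b (tconst T v0) 1 (tsec T 'X)).
  apply: is_pt_exists => //; rewrite admissible_at; exists 1, 0.
  by rewrite mulr1 mul0r addr0.
have resE z e : tpt T z (tconst T e) = tresE T e by rewrite /= tev_const.
have bcg z : base_change (tpt T z) (base_change (tconst T) g) = base_change (tresE T) g.
  rewrite -base_change_comp; congr (base_change _ g); apply: lrmorphism_eq.
  by apply/funext => e; exact: resE.
have bcg' z : base_change (tev T z) (base_change (tconst T) g) = g.
  rewrite -base_change_comp -[RHS]base_change_id; congr (base_change _ g).
  by apply: lrmorphism_eq; apply/funext => e; exact: tev_const.
have red (w : Wn k 2 (tA T)) x y : is_pt w (tconst T t) (at_chart b (tconst T v0) x y) ->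
  forall z, exists v x y,
      is_pt (base_change (tpt T z) (alpha (tA T) (base_change (tconst T) g) w)) 0
        (at_chart b' v x y).
  move=> wP z; rewrite act_bc bcg; apply: (Hk (tpt T z x) (tpt T z y)).
  by have := is_pt_bc (tpt T z) wP; rewrite at_chart_map !resE tres0.
have [V1 V1P] := regular_v (red _ _ _ w1P).
have [V2 V2P] := regular_v (red _ _ _ w2P).
(* The v-coordinate of the image is a function on either chart; the two functions correspond under z
   |-> 1/z, so they are constant. *)
have [|V VE] := @tev_inv_const k T V1 V2.
  move=> z z0.
  have [x1 [y1 h1]] := V1P _ (@tE_local k T) (tev T z).
  have [x2 [y2 h2]] := V2P _ (@tE_local k T) (tev T z^-1).
  have same : base_change (tev T z) w1 = base_change (tev T z^-1) w2.
    have := is_pt_bc (tev T z) w1P; have := is_pt_bc (tev T z^-1) w2P.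
    rewrite !at_chart_map !tev_const !tev_secX !rmorph1 => p2 p1.
    apply: is_pt_unique p2; apply: is_pt_same p1 _; rewrite W_same_eq; split=> //.
    split; first exact: unimod_pt.
    by exists (z^-1)%:A, z%:A; rewrite mulr1 -scalerAl mul1r scalerA mulVf // scale1r.
  have germE z' (w : Wn k 2 (tA T)) :
      germ_of (alpha (tA T) (base_change (tconst T) g) w) (@tE_local k T) (tev T z') =
      germ_of (alpha (tE T) g (base_change (tev T z') w)) (@tE_local k T) idfun.
    rewrite -{2}(bcg' z') -act_bc germ_bc; congr (germ_of _ _ _); exact: lrmorphism_eq.
  move: h1 h2; rewrite !germE same.
  have [d [_ ->]] :=
    germ_local (alpha (tE T) g (base_change (tev T z^-1) w2)) (@tE_local k T) idfun.
  move=> /= h1 h2; have := W_same_trans (W_same_sym h1) h2.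
  by rewrite W_same_eq => -[].
exists V => B locB phi p w wP.
(* Every point of the fibre with affine coordinate [p] is a specialisation of the universal point
   [w1]. *)
have [psi [psiE psiX]] := @tuniv k T B phi p.
have ww : base_change psi w1 = w.
  apply: is_pt_unique wP; have := is_pt_bc psi w1P.
  by rewrite at_chart_map !psiE psiX rmorph1.
have [x [y h]] := V1P B locB psi; exists x, y.
rewrite -ww; have -> : base_change phi g = base_change psi (base_change (tconst T) g).
  rewrite -base_change_comp; congr (base_change _ g); apply: lrmorphism_eq.
  by apply/funext => e /=; rewrite psiE.
rewrite -act_bc germ_bc.
have -> : (idfun \o psi : {lrmorphism tA T -> B}) = psi by exact: lrmorphism_eq.
by rewrite -psiE -VE.
Qed.

(** The lift is evaluated at a universal point: v is the variable of [T], and p a further cube-zero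
    parameter adjoined by [thickS]. The hypotheses on the central fibre keep the image in the chart
    [b'] and away from y = 0, so [regular_pt] provides coordinates, which naturality specialises. By
    [fibre_constant] the new v does not involve p. *)
Lemma normal_form (T : thick k) (g : G (tE T)) (t : tE T) (b b' : bool) :
  t ^+ 3 = 0 ->
  (forall z x y (w : Wn k 2 k^o), is_pt w 0 (at_chart b z x y) ->
     exists v1 x1 y1, is_pt (alpha k^o (base_change (tresE T) g) w) 0 (at_chart b' v1 x1 y1)) ->
  (forall z x (w : Wn k 2 k^o), is_pt w 0 (at_chart b z x 1) ->
     exists v1 x1, is_pt (alpha k^o (base_change (tresE T) g) w) 0 (at_chart b' v1 x1 1)) ->
  exists (t' : tE T) (V : tA T) (P : trunc3 (tA T)),
  forall (B : comAlgType k) (phi : {lrmorphism tE T -> B}) (psi : {lrmorphism tA T -> B})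
      (p : B) (w : Wn k 2 B),
    (forall e, psi (tconst T e) = phi e) -> p ^+ 3 = 0 ->
    is_pt w (phi t) (at_chart b (psi (tsec T 'X)) p 1) ->
    is_pt (alpha B (base_change phi g) w) (phi t') (at_chart b' (psi V) (lift3 psi p P) 1).
Proof.
move=> t3 Hk Hk1.
have tres0 : tresE T t = 0 by apply: (@field_nilp _ 3); exact: rmorph_nilp.
pose S := thickS T.
pose j : {lrmorphism tE T -> tA S} := cst3m (tA T) \o tconst T.
have jt3 : j t ^+ 3 = 0 by exact: rmorph_nilp.
have [w1 w1P] : exists w1 : Wn k 2 (tA S),
    is_pt w1 (j t) (at_chart b (tsec S 'X) (gen3 : trunc3 (tA T)) 1).
  by apply: is_pt_exists => //; rewrite admissible_at; exact: unimod_pt.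
set gS := base_change j g : G (tA S).
pose w' := alpha (tA S) gS w1.
have bcg (B : comAlgType k) (chi : {lrmorphism tA S -> B}) (f : {lrmorphism tE T -> B}) :
    (forall e, chi (j e) = f e) -> base_change chi gS = base_change f g.
  move=> E; rewrite /gS -base_change_comp; congr (base_change _ g).
  by apply: lrmorphism_eq; apply/funext.
have [|V' [P w'P]] := @regular_pt k 2 S w' b'.
  move=> z; rewrite /w' act_bc (bcg _ (tpt S z) (tresE T)); last first.
    by move=> e; rewrite /= tev_const.
  apply: (Hk1 (tpt S z (tsec S 'X)) (tpt S z gen3)).
  have := is_pt_bc (tpt S z) w1P; rewrite at_chart_map rmorph1.
  by have -> : tpt S z (j t) = 0 by rewrite /= tev_const.
(* The image of t depends on t alone, so it may be computed at v = p = 0; it therefore lies in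
   [tE T]. *)
have [w0 w0P] : exists w0 : Wn k 2 (tE T), is_pt w0 t (at_chart b 0 0 1).
  by apply: is_pt_exists => //; rewrite admissible_at; exact: unimod_pt.
pose t' := W_pi (proj1_sig (alpha (tE T) g w0)).
have tE' : W_pi (proj1_sig w') = j t'.
  have -> : j t' = W_pi (proj1_sig (base_change j (alpha (tE T) g w0))) by [].
  rewrite act_bc; apply: act_base.
  by have [-> _ _] := w1P; have [-> _ _] := is_pt_bc j w0P.
have V'E : V' = cst3 (co0 V').
  have cv z : tev S z V' = cst3 (tev T z (co0 V')).
    have [V HV] := fibre_constant t3 (fun x y w => Hk (tresE T z%:A) x y w).
    have evP := is_pt_bc (tev S z) w'P.
    have w1P' : is_pt (base_change (tev S z) w1) (cst3m (tE T) t)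
        (at_chart b (cst3m (tE T) z%:A) gen3 1).
      have := is_pt_bc (tev S z) w1P; rewrite at_chart_map rmorph1.
      rewrite [tev S z (j t)](_ : _ = cst3m (tE T) t); last first.
        by apply: eq3; rewrite /= ?co3E ?tev_const ?rmorph0.
      rewrite tev_secX [tev S z gen3](_ : _ = gen3); last first.
        by apply: eq3; rewrite /= ?co3E ?rmorph0 ?rmorph1.
      by rewrite -[z%:A in X in X -> _](rmorph_alg (cst3m (tE T))).
    have [x [y]] := HV _ (@tE_local k S) (cst3m (tE T)) gen3 _ w1P'.
    rewrite -(bcg _ (tev S z)); last first.
      by move=> e; apply: eq3; rewrite /= ?co3E ?tev_const ?rmorph0.
    rewrite -act_bc; move: evP => [_ _ ->].
    rewrite !at_chart_map /= => /W_same_eq [E _].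
    have {}E : tev S z V' = cst3 V by rewrite [RHS]E.
    rewrite E; congr cst3; exact: esym (congr1 (@co0 _ _) E).
  have d (c : tA T) : (forall z, tev T z c = 0) -> c = 0.
    by move=> H; apply: (@tev_detect k T 1) => [|z _]; rewrite ?oner_neq0.
  apply: eq3; rewrite ?co3E //; apply: d => z.
    by have := congr1 (@co1 _ _) (cv z); rewrite map3E co3E.
  by have := congr1 (@co2 _ _) (cv z); rewrite map3E co3E.
exists t', (co0 V'), P => B phi psi p w psiE p3 wP.
pose chi : {lrmorphism tA S -> B} := liftm psi p3.
have chiE x : chi (cst3 x) = psi x.
  by rewrite /= /liftm /lift3 !co3E !rmorph0 !mul0r !addr0.
have -> : w = base_change chi w1.
  apply: is_pt_unique wP _; have := is_pt_bc chi w1P.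
  rewrite at_chart_map rmorph1 chiE [chi gen3](_ : _ = p) ?chiE ?psiE //.
  by rewrite /= /liftm /lift3 !co3E !rmorph0 rmorph1 mul0r addr0 add0r mul1r.
rewrite -(bcg _ chi) -?act_bc; last first.
  by move=> e; rewrite /j /= -[liftm _ _ _]/(chi _) chiE.
have := is_pt_bc chi w'P; rewrite at_chart_map rmorph1 tE' V'E !chiE psiE.
by [].
Qed.
End Action.

Lemma lift3_cst (k : fieldType) (B C : comAlgType k) (chi : {lrmorphism B -> C}) (x : trunc3 B) :
  lift3 (cst3m C \o chi) gen3 x = map3m chi x.
Proof. by apply: eq3; rewrite /lift3 expr2 ?map3E !co3E /=; ring. Qed.

(** * Translations and automorphisms with constant coefficients *)

Section Elements.
Variable k : fieldType.
Local Notation G := (Aut (F2 k)).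

(* The translations [x:y:z] |-> [x+ey:y:z] and [x+ez:y:z], i.e. the binary
   quadratic forms [e u^2] and [e v^2]. *)
Definition translation (A : comPzRingType) (i : bool) (e : A) : linear_map A :=
  Lin 1 (if i then 0 else e) (if i then e else 0) 1 1 false.

Lemma translation_inverse (A : comPzRingType) i (e : A) :
  lin_inverse (translation i e) (translation i (- e)).
Proof.
by case: i; split; rewrite /lin_mul /lin_one /translation /=; congr Lin; ring.
Qed.

Definition translation_aut (A : comAlgType k) (i : bool) (e : A) : G A :=
  lin_aut (translation_inverse i e).

Lemma translation_aut_bc (A B : comAlgType k) (phi : {lrmorphism A -> B}) i e :
  base_change phi (translation_aut i e) = translation_aut i (phi e).
Proof.
rewrite /translation_aut lin_aut_bc; apply: lin_aut_eq.
by case: i; rewrite /lin_map /translation /= ?rmorphN ?rmorph0 ?rmorph1.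
Qed.

Lemma translation_aut0 (A : comAlgType k) i : translation_aut i (0 : A) = gone G A.
Proof. by apply: lin_aut_one; case: i; rewrite /translation /lin_one oppr0. Qed.

Lemma translation_autC (A : comAlgType k) i i' (e e' : A) :
  gmul (translation_aut i e) (translation_aut i' e') =
  gmul (translation_aut i' e') (translation_aut i e).
Proof.
apply: lin_aut_relation; case: i; case: i' => /=;
  rewrite /lin_mul /translation /=; congr Lin; ring.
Qed.

Definition constant_aut (p p' : linear_map k^o) (pp' : lin_inverse p p') (A : comAlgType k) : G A :=
  lin_aut (lin_inverse_map (scal A) pp').

Lemma constant_aut_bc (A B : comAlgType k) (phi : {lrmorphism A -> B}) p p'
    (pp' : lin_inverse p p') :
  base_change phi (constant_aut pp' A) = constant_aut pp' B.
Proof.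
rewrite /constant_aut lin_aut_bc; apply: lin_aut_eq.
have E c : phi (scal A c) = scal B c by exact: rmorph_alg.
by case: p' pp' => l a b c d s pp'; rewrite /lin_map /= !E.
Qed.

(** The form u^2 or v^2 in the affine coordinate of a chart: 1 in the chart where its variable is
    normalised to 1, and the square of the coordinate in the other. *)
Definition qform (A : comPzRingType) (c : bool) (v : A) : A := if c then 1 else v ^+ 2.

Lemma translation_central (A : comPzRingType) i (e : A) b v x y :
  lin_apply (translation i e) (central_fiber_map (at_chart b v x y)) =
  central_fiber_map (at_chart b v (x + e * qform (i == b) v * y) y).
Proof. by case: i; case: b; rewrite /= /qform; congr F2_at; ring. Qed.

Lemma qform_map (A B : comAlgType k) (phi : {lrmorphism A -> B}) c v :
  phi (qform c v) = qform c (phi v).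
Proof. by case: c; rewrite /= ?rmorph1 ?rmorphXn. Qed.
End Elements.

Section Action.
Variables (k : numClosedFieldType).
Variable alpha : algebraic_action (Aut (F2 k)) (Wn k 2).
Variable beta : algebraic_action (Aut (F2 k)) (base k 2).
Hypothesis Hpi : pi_equivariant alpha beta.
Hypothesis Hf : f_equivariant (tautological_action (F2 k)) alpha.
Local Notation G := (Aut (F2 k)).

Lemma act_translation_central (A : comAlgType k) i (e : A) b v x y (w : Wn k 2 A) :
  is_pt w 0 (at_chart b v x y) ->
  is_pt (alpha A (translation_aut i e) w) 0 (at_chart b v (x + e * qform (i == b) v * y) y).
Proof.
move=> wP; have [_ adm _] := wP; apply: tautological_pt Hf _ _ wP; last exact: translation_central.
move: adm; rewrite !admissible_at => -[a [c h]].
by exists a, (c - a * (e * qform (i == b) v)); rewrite -h; ring.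
Qed.

(** The normal form is taken over k[e, t], e being the outer parameter. Terms free of e are those of
    the identity, terms free of t those of the tautological action. The rest are the unknowns, [rij]
    being the coefficient of e p^i t^j in the fibre coordinate. *)
Lemma translation_normal_form (i b : bool) :
  exists (c0 c1 : k) (X Y r01 r02 r11 r12 : {poly k}),
  forall (B : comAlgType k) (t e v p : B) (w : Wn k 2 B),
    t ^+ 3 = 0 -> e ^+ 2 = 0 -> p ^+ 2 = 0 -> is_pt w t (at_chart b v p 1) ->
    is_pt (alpha B (translation_aut i e) w) (t + e * (c0%:A * t + c1%:A * t ^+ 2))
      (at_chart b (v + e * (t * pev v X + t ^+ 2 * pev v Y))
        (p + e * (qform (i == b) v + t * pev v r01 + t ^+ 2 * pev v r02 +
                  p * (t * pev v r11 + t ^+ 2 * pev v r12))) 1).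
Proof.
pose T0 := thickS (thick0 k); pose T := thickS T0.
pose t0 : tE T := cst3 gen3; pose e0 : tE T := gen3.
have t03 : t0 ^+ 3 = 0 by rewrite /t0 -(rmorphXn (cst3m (tE T0))) gen3_cube rmorph0.
have [||t' [V [P H]]] := @normal_form k alpha beta Hpi T (translation_aut i e0) t0 b b t03.
- move=> z x y w wP; rewrite translation_aut_bc; do 3!eexists; exact: act_translation_central wP.
- move=> z x w wP; rewrite translation_aut_bc; do 2!eexists; exact: act_translation_central wP.
have {}H (B : comAlgType k) (psi : {lrmorphism tA T -> B}) (p : B) (w : Wn k 2 B) :
    p ^+ 3 = 0 -> is_pt w (psi (tconst T t0)) (at_chart b (psi (tsec T 'X)) p 1) ->
    is_pt (alpha B (translation_aut i (psi (tconst T e0))) w) (psi (tconst T t'))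
      (at_chart b (psi V) (lift3 psi p P) 1).
  move=> p3 wP; have := H B (psi \o tconst T) psi p w (fun e => erefl) p3 wP.
  by rewrite translation_aut_bc.
have pt_ex (B : comAlgType k) (psi : {lrmorphism tA T -> B}) (p : B) :
    exists w : Wn k 2 B, is_pt w (psi (tconst T t0)) (at_chart b (psi (tsec T 'X)) p 1).
  apply: is_pt_exists; last by rewrite admissible_at; exact: unimod_pt.
  by apply: rmorph_nilp; exact: rmorph_nilp.
(* specialization at [e = 0], where the translation is the identity *)
pose psi1 : {lrmorphism tA T -> tA T} := cst3m (tA T0) \o co0m (tA T0).
have [w1 w1P] := pt_ex _ psi1 gen3.
have := H _ psi1 gen3 w1 (gen3_cube _) w1P.
rewrite [psi1 (tconst T e0)](_ : _ = 0) ?translation_aut0 ?act1; last first.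
  by apply: eq3; rewrite /= ?co3E ?rmorph0.
move=> /(@is_pt_inj_thick k 2 T) /(_ w1P) [Et1 EV1 EP1].
(* specialization at [t = 0], the central fibre *)
pose psi2 : {lrmorphism tA T -> tA T} := cst3m (tA T0) \o map3m (co0m {poly k}).
have [w2 w2P] := pt_ex _ psi2 gen3.
have z0 : psi2 (tconst T t0) = 0 by apply: eq3; apply: eq3; rewrite /= ?co3E ?rmorph0.
have := H _ psi2 gen3 w2 (gen3_cube _) w2P; rewrite z0 in w2P *.
move=> /(@is_pt_inj_thick k 2 T) /(_ (act_translation_central i _ w2P)) [Et2 EV2 EP2].
have inj (c d : k^o) : scal {poly k} c = scal {poly k} d -> c = d.
  by rewrite !polyC_algE => /polyC_inj.
have t00 : co0 (co0 t') = 0 by apply: inj; exact: (congr1 (fun z => co0 (co0 z)) Et1).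
have t01 : co1 (co0 t') = 1 by apply: inj; exact: (congr1 (fun z => co1 (co0 z)) Et1).
have t02 : co2 (co0 t') = 0 by apply: inj; exact: (congr1 (fun z => co2 (co0 z)) Et1).
have t10 : co0 (co1 t') = 0 by
  apply: inj; rewrite rmorph0; exact: (congr1 (fun z => co1 (co0 z)) Et2).
have V0 : co0 V = cst3 'X by exact: (congr1 (@co0 _ _) EV1).
have V10 : co0 (co1 V) = 0 by exact: (congr1 (fun z => co1 (co0 z)) EV2).
move: EP1; rewrite /psi1 lift3_cst => EP1.
have P00 : co0 (co0 P) = 0 by exact: (congr1 (@co0 _ _) EP1).
have P10 : co0 (co1 P) = 1 by exact: (congr1 (@co1 _ _) EP1).
have {EP2}EP2 : map3m (map3m (co0m {poly k})) P = gen3 + cst3 (gen3 * cst3 (qform (i == b) 'X)).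
  rewrite -lift3_cst [LHS]EP2 mulr1.
  have -> : psi2 (tsec T 'X) = cst3m (tA T0) (cst3m {poly k} 'X).
    by apply: eq3; apply: eq3; rewrite /= ?co3E ?rmorph0.
  have -> : psi2 (tconst T e0) = cst3m (tA T0) gen3.
    by apply: eq3; apply: eq3; rewrite /= ?co3E ?rmorph0 ?rmorph1.
  by rewrite -!qform_map -rmorphM.
have P01 : co0 (co1 (co0 P)) = qform (i == b) 'X.
  have := congr1 (fun z => co1 (co0 z)) EP2; rewrite /= !co3E => E.
  by rewrite [LHS]E; ring.
have P11 : co0 (co1 (co1 P)) = 0.
  have E : co0 (co1 (co1 P)) = 0 + 0 := congr1 (fun z => co1 (co1 z)) EP2.
  by rewrite E addr0.
exists (co1 (co1 t')), (co2 (co1 t')), (co1 (co1 V)), (co2 (co1 V)),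
  (co1 (co1 (co0 P))), (co2 (co1 (co0 P))), (co1 (co1 (co1 P))), (co2 (co1 (co1 P))).
move=> B t e v p w t3 e2 p2 wP.
have e3 : e ^+ 3 = 0 by rewrite exprS e2 mulr0.
have p3 : p ^+ 3 = 0 by rewrite exprS p2 mulr0.
pose psi : {lrmorphism tA T -> B} := liftm (liftm (pev v) t3 : {lrmorphism tA T0 -> B}) e3.
have psiE x : psi x = (pev v (co0 (co0 x)) + pev v (co1 (co0 x)) * t + pev v (co2 (co0 x)) * t ^+ 2)
   + (pev v (co0 (co1 x)) + pev v (co1 (co1 x)) * t + pev v (co2 (co1 x)) * t ^+ 2) * e.
  by rewrite [LHS]/(lift3 _ _ _) /lift3 e2 mulr0 addr0.
have psic x : psi (tconst T x) =
    (co0 (co0 x))%:A + (co1 (co0 x))%:A * t + (co2 (co0 x))%:A * t ^+ 2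
   + ((co0 (co1 x))%:A + (co1 (co1 x))%:A * t + (co2 (co1 x))%:A * t ^+ 2) * e.
  have pc (c : k^o) : pev v (scal {poly k} c) = c%:A by exact: rmorph_alg.
  by rewrite -!pc; exact: psiE.
have psit : psi (tconst T t0) = t.
  transitivity ((0 : k)%:A + (1 : k)%:A * t + (0 : k)%:A * t ^+ 2
     + ((0 : k)%:A + (0 : k)%:A * t + (0 : k)%:A * t ^+ 2) * e); first exact: psic.
  by rewrite !scale0r scale1r; ring.
have psie : psi (tconst T e0) = e.
  transitivity ((0 : k)%:A + (0 : k)%:A * t + (0 : k)%:A * t ^+ 2
     + ((1 : k)%:A + (0 : k)%:A * t + (0 : k)%:A * t ^+ 2) * e); first exact: psic.
  by rewrite !scale0r scale1r; ring.
have psiX : psi (tsec T 'X) = v.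
  transitivity (pev v 'X + pev v 0 * t + pev v 0 * t ^+ 2
     + (pev v 0 + pev v 0 * t + pev v 0 * t ^+ 2) * e); first exact: psiE.
  by rewrite !rmorph0 pevX; ring.
have := H B psi p w p3; rewrite psit psie psiX => /(_ wP).
have -> : psi (tconst T t') = t + e * ((co1 (co1 t'))%:A * t + (co2 (co1 t'))%:A * t ^+ 2).
  by rewrite psic t00 t01 t02 t10 !scale0r scale1r; ring.
have -> : psi V = v + e * (t * pev v (co1 (co1 V)) + t ^+ 2 * pev v (co2 (co1 V))).
  rewrite psiE V10 V0 [co0 (cst3 _)]/('X) [co1 (cst3 _)]/(0) [co2 (cst3 _)]/(0).
  by rewrite !rmorph0 pevX; ring.
rewrite /lift3 p2 mulr0 addr0 !psiE P00 P10 P01 P11 qform_map pevX.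
rewrite [co0 0]/(0) [co1 0]/(0) [co2 0]/(0) [co0 1]/(1) [co1 1]/(0) [co2 1]/(0) !rmorph0 rmorph1.
move=> h; congr (is_pt _ _ (at_chart b _ _ 1)): h; ring.
Qed.
End Action.

(** * Automorphisms with constant coefficients, to first order in t *)

Section Constants.
Variables (k : numClosedFieldType).
Variable alpha : algebraic_action (Aut (F2 k)) (Wn k 2).
Variable beta : algebraic_action (Aut (F2 k)) (base k 2).
Hypothesis Hpi : pi_equivariant alpha beta.
Hypothesis Hf : f_equivariant (tautological_action (F2 k)) alpha.
Local Notation G := (Aut (F2 k)).

Definition base_scale p p' (pp' : lin_inverse p p') (c : k) : Prop :=
  forall (B : comAlgType k) (s : base k 2 B), proj1_sig s ^+ 2 = 0 ->
    proj1_sig (beta B (constant_aut pp' B) s) = c%:A * proj1_sig s.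

(** At the universal point of the base the image of t has coefficients in k. Its constant term is
    nilpotent, hence zero, and only the linear term is seen when t^2 = 0. *)
Lemma constant_aut_base p p' (pp' : lin_inverse p p') : exists c, base_scale pp' c.
Proof.
pose E : comAlgType k := trunc3 k^o.
pose s0 : base k 2 E := exist _ gen3 (gen3_cube _).
pose t' := proj1_sig (beta E (constant_aut pp' E) s0).
have t'3 : t' ^+ 3 = 0 := proj2_sig (beta E (constant_aut pp' E) s0).
have t0 : co0 t' = 0.
  by apply: (@field_nilp k _ 3); rewrite -(rmorphXn (co0m k^o)) t'3 rmorph0.
exists (co1 t') => B [t t3] /= t2.
pose phi : {lrmorphism E -> B} := liftm (scal B) t3.
have sE : base_change phi s0 = exist _ t t3 :> base k 2 B.
  by apply: sig_eq; rewrite /= /liftm /lift3 !co3E rmorph0 rmorph1 mul0r mul1r add0r addr0.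
rewrite -sE -(constant_aut_bc phi) -act_nat.
rewrite [LHS]/(phi t') [LHS]/(lift3 (scal B) t t') /lift3 t0 t2 rmorph0 add0r mulr0 addr0.
by [].
Qed.

Lemma constant_aut_cancel p p' (pp' : lin_inverse p p')
    (p'p : lin_inverse p' p) (B : comAlgType k) :
  gmul (constant_aut p'p B) (constant_aut pp' B) = gone G B.
Proof.
have oo : lin_inverse (lin_one B) (lin_one B).
  by split; rewrite /lin_mul /lin_one /=; congr Lin; ring.
rewrite -(lin_aut_one oo erefl); apply: lin_autM.
by have [_ ->] := lin_inverse_map (scal B) pp'.
Qed.

Lemma base_scale_neq0 p p' (pp' : lin_inverse p p') c : base_scale pp' c -> c != 0.
Proof.
move=> Hc; have [c' Hc'] := constant_aut_base (lin_inverse_sym pp').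
pose E : comAlgType k := trunc3 k^o.
(* A nonzero element of square zero; on it the scalars of the automorphism and of its inverse
   multiply to 1. *)
pose g2 : E := gen3 ^+ 2.
have g22 : g2 ^+ 2 = 0 by rewrite -exprM exprS gen3_cube mulr0.
have g23 : g2 ^+ 3 = 0 by rewrite exprS g22 mulr0.
pose s : base k 2 E := exist _ g2 g23.
have h1 := Hc E s g22; have h2 := Hc' E (beta E (constant_aut pp' E) s).
have := congr1 (@proj1_sig _ _)
  (actM beta (constant_aut (lin_inverse_sym pp') E) (constant_aut pp' E) s).
rewrite constant_aut_cancel act1 h2 h1; last by rewrite exprMn g22 mulr0.
move=> /(congr1 (@co2 _ _)) E1; apply/eqP => c0; move: E1; rewrite c0 scale0r mul0r mulr0 => E1.
have : (1 : k^o) = 0.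
  by rewrite -[RHS]E1 /= /g2 expr2 !co3E; ring.
by move/eqP; rewrite oner_eq0.
Qed.

(** The correction [s] in the fibre direction is left unspecified, since the relations with
    translations are read off the v-coordinate. *)
Lemma constant_aut_normal_form p p' (pp' : lin_inverse p p') (c d : k) b b' :
  base_scale pp' c ->
  (forall (A : comAlgType k) (v x y : A),
    lin_apply (lin_map (scal A) p) (central_fiber_map (at_chart b v x y)) =
    central_fiber_map (at_chart b' (d%:A * v) x y)) ->
  exists X : {poly k},
  forall (B : comAlgType k) (t v q : B) (w : Wn k 2 B),
    t ^+ 2 = 0 -> q ^+ 2 = 0 -> is_pt w t (at_chart b v q 1) ->
    exists s, is_pt (alpha B (constant_aut pp' B) w) (c%:A * t)
      (at_chart b' (d%:A * v + t * pev v X) (q + t * s) 1).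
Proof.
move=> Hc Hp.
pose T := thickS (thick0 k); pose t0 : tE T := gen3.
have act0 (A : comAlgType k) v x y (w : Wn k 2 A) : is_pt w 0 (at_chart b v x y) ->
    is_pt (alpha A (constant_aut pp' A) w) 0 (at_chart b' (d%:A * v) x y).
  move=> wP; have [_ adm _] := wP; apply: tautological_pt Hf _ _ wP; last exact: Hp.
  by move: adm; rewrite !admissible_at.
have [||t' [V [P H]]] :=
  @normal_form k alpha beta Hpi T (constant_aut pp' (tE T)) t0 b b' (gen3_cube _).
- move=> z x y w wP; rewrite constant_aut_bc; do 3!eexists; exact: act0 wP.
- move=> z x w wP; rewrite constant_aut_bc; do 2!eexists; exact: act0 wP.
have {}H (B : comAlgType k) (psi : {lrmorphism tA T -> B}) (q : B) (w : Wn k 2 B) :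
    q ^+ 3 = 0 -> is_pt w (psi (tconst T t0)) (at_chart b (psi (tsec T 'X)) q 1) ->
    is_pt (alpha B (constant_aut pp' B) w) (psi (tconst T t'))
      (at_chart b' (psi V) (lift3 psi q P) 1).
  move=> q3 wP; have := H B (psi \o tconst T) psi q w (fun e => erefl) q3 wP.
  by rewrite constant_aut_bc.
pose T0 := thick0 k.
pose psi0 : {lrmorphism tA T -> tA T} := cst3m (tA T0) \o co0m (tA T0).
have z0 : psi0 (tconst T t0) = 0 by apply: eq3; rewrite /= ?co3E ?rmorph0.
have [w0 w0P] : exists w : Wn k 2 (tA T), is_pt w 0 (at_chart b (psi0 (tsec T 'X)) gen3 1).
  by apply: is_pt_exists; [rewrite expr0n | rewrite admissible_at; exact: unimod_pt].
have := H _ psi0 gen3 w0 (gen3_cube _); rewrite z0 => /(_ w0P).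
move=> /(@is_pt_inj_thick k 2 T) /(_ (act0 _ _ _ _ _ w0P)) [_ EV EP].
have V0 : co0 V = d%:A * 'X.
  have := congr1 (@co0 _ _) EV; rewrite co0M => E; apply: etrans E _; congr (_ * _).
move: EP; rewrite /psi0 lift3_cst => EP.
have P0 : co0 (co0 P) = 0 by exact: (congr1 (@co0 _ _) EP).
have P1 : co0 (co1 P) = 1 by exact: (congr1 (@co1 _ _) EP).
exists (co1 V) => B t v q w t2 q2 wP.
have t3 : t ^+ 3 = 0 by rewrite exprS t2 mulr0.
have q3 : q ^+ 3 = 0 by rewrite exprS q2 mulr0.
pose psi : {lrmorphism tA T -> B} := liftm (pev v) t3.
have psiE x : psi x = pev v (co0 x) + pev v (co1 x) * t.
  by rewrite [LHS]/(lift3 _ _ _) /lift3 t2 mulr0 addr0.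
have psit : psi (tconst T t0) = t.
  transitivity (pev v (scal {poly k} 0) + pev v (scal {poly k} 1) * t); first exact: psiE.
  by rewrite !rmorph0 !rmorph1; ring.
have psiX : psi (tsec T 'X) = v.
  transitivity (pev v 'X + pev v 0 * t); first exact: psiE.
  by rewrite !rmorph0 pevX; ring.
have := H B psi q w q3; rewrite psit psiX => /(_ wP) wP'.
exists (pev v (co1 (co0 P)) + pev v (co1 (co1 P)) * q).
have -> : c%:A * t = psi (tconst T t').
  have [<- _ _] := wP'; have := congr1 (@proj1_sig _ _) (Hpi (constant_aut pp' B) w).
  rewrite /= => ->; rewrite Hc /=; by have [-> _ _] := wP.
have -> : d%:A * v + t * pev v (co1 V) = psi V.
  by rewrite psiE V0 rmorphM /= pevX rmorph_alg mulrC [t * _]mulrC [v * _]mulrC.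
have -> // : q + t * (pev v (co1 (co0 P)) + pev v (co1 (co1 P)) * q) = lift3 psi q P.
rewrite /lift3 q2 mulr0 addr0 !psiE P0 P1 rmorph0 rmorph1; ring.
Qed.
End Constants.

(** * Relations between the lifts *)

Section Relations.
Variable k : numClosedFieldType.
Local Notation G := (Aut (F2 k)).

Lemma two_neq0 : (2 : k) != 0. Proof. by rewrite pnatr_eq0. Qed.

Lemma doubling_inverse :
  lin_inverse (Lin 2 0 0 1 1 false : linear_map k^o) (Lin (2^-1 : k) 0 0 1 1 false).
Proof.
have h : (2 : k^o) * (2^-1 : k) = 1 by exact: mulfV two_neq0.
split; rewrite /lin_mul /lin_one /=; congr Lin; try ring; first exact: h.
by rewrite mulrC; exact: h.
Qed.

Lemma torus_inverse :
  lin_inverse (Lin 1 0 0 1 2 false : linear_map k^o) (Lin 1 0 0 1 (2^-1 : k) false).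
Proof.
have h : (2 : k^o) * (2^-1 : k) = 1 by exact: mulfV two_neq0.
split; rewrite /lin_mul /lin_one /=; congr Lin; try ring; first exact: h.
by rewrite mulrC; exact: h.
Qed.

Lemma swap_inverse :
  lin_inverse (Lin 1 0 0 1 1 true : linear_map k^o) (Lin 1 0 0 1 1 true).
Proof. by split; rewrite /lin_mul /lin_one /=; congr Lin; ring. Qed.

Lemma doubling_translation (A : comAlgType k) i (e : A) :
  gmul (constant_aut doubling_inverse A) (translation_aut i e) =
  gmul (translation_aut i (2 * e)) (constant_aut doubling_inverse A).
Proof.
have h2 : 2 * scal A (2^-1 : k) = 1.
  have h : (2 : k^o) * (2^-1 : k) = 1 by exact: mulfV two_neq0.
  by rewrite -[2 in LHS](rmorph_nat (scal A)) -rmorphM h rmorph1.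
apply: lin_aut_relation; case: i; rewrite /lin_mul /lin_map /translation /=;
  congr Lin; rewrite ?rmorph0 ?rmorph1; try ring;
  by transitivity (- (2 * scal A (2^-1 : k) * e)); [rewrite h2|]; ring.
Qed.

(** The torus element multiplies v by 2 and fixes u, hence fixes the form e u^2. *)
Lemma torus_translation (A : comAlgType k) (e : A) :
  gmul (constant_aut torus_inverse A) (translation_aut false e) =
  gmul (translation_aut false e) (constant_aut torus_inverse A).
Proof.
by apply: lin_aut_relation; rewrite /lin_mul /lin_map /translation /=;
  congr Lin; rewrite ?rmorph0 ?rmorph1; ring.
Qed.

Lemma swap_translation (A : comAlgType k) (e : A) :
  gmul (constant_aut swap_inverse A) (translation_aut false e) =
  gmul (translation_aut true e) (constant_aut swap_inverse A).
Proof.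
by apply: lin_aut_relation; rewrite /lin_mul /lin_map /translation /=;
  congr Lin; rewrite ?rmorph0 ?rmorph1; ring.
Qed.
End Relations.

(** * Reading off coefficients, and the action of translations on the base *)

Section Identities.
Variables (k : numClosedFieldType).
Variable alpha : algebraic_action (Aut (F2 k)) (Wn k 2).
Variable beta : algebraic_action (Aut (F2 k)) (base k 2).
Hypothesis Hpi : pi_equivariant alpha beta.
Hypothesis Hf : f_equivariant (tautological_action (F2 k)) alpha.
Local Notation G := (Aut (F2 k)).

Definition translation_form (i b : bool) (c1 : k) (X Y r01 r02 r11 r12 : {poly k}) : Prop :=
  forall (B : comAlgType k) (t e v p : B) (w : Wn k 2 B),
    t ^+ 3 = 0 -> e ^+ 2 = 0 -> p ^+ 2 = 0 -> is_pt w t (at_chart b v p 1) ->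
    is_pt (alpha B (translation_aut i e) w) (t + e * (c1%:A * t ^+ 2))
      (at_chart b (v + e * (t * pev v X + t ^+ 2 * pev v Y))
        (p + e * (qform (i == b) v + t * pev v r01 + t ^+ 2 * pev v r02 +
                  p * (t * pev v r11 + t ^+ 2 * pev v r12))) 1).

Lemma sqgen_sq (B : comAlgType k) : ((gen3 : trunc3 B) ^+ 2) ^+ 2 = 0.
Proof. by rewrite -exprM exprS gen3_cube mulr0. Qed.

Lemma act_pi (B : comAlgType k) (g : G B) (w : Wn k 2 B) (s : base k 2 B) :
  W_pi (proj1_sig w) = proj1_sig s ->
  W_pi (proj1_sig (alpha B g w)) = proj1_sig (beta B g s).
Proof.
move=> e; have := congr1 (@proj1_sig _ _) (Hpi g w); rewrite /= => ->.
by congr (proj1_sig (beta B g _)); exact: sig_eq.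
Qed.

Lemma algM (B : comAlgType k) (a b : k) : (a * b)%:A = a%:A * b%:A :> B.
Proof. by rewrite -scalerAl mul1r scalerA. Qed.

Lemma algD (B : comAlgType k) (a b : k) : (a + b)%:A = a%:A + b%:A :> B.
Proof. by rewrite scalerDl. Qed.

Lemma coef_sqgen (B : comAlgType k) (x : B) (y : trunc3 B) :
  gen3 ^+ 2 * y = 0 -> y = cst3 x -> x = 0.
Proof. by move=> + yx; rewrite yx => /(congr1 (@co2 _ _)); rewrite expr2 /= !co3E => <-; ring. Qed.

Lemma cst3_alg (B : comAlgType k) (a : k) : a%:A = cst3 (a%:A : B).
Proof. by rewrite -(rmorph_alg (cst3m B)). Qed.

Lemma cst3_mul_alg (B : comAlgType k) (x : B) (a : k) : cst3 x * a%:A = cst3 (x * a%:A).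
Proof. by rewrite cst3_alg -(rmorphM (cst3m B)). Qed.

Lemma alg_eq0 (a : k) : (a%:A : k^o) = 0 -> a = 0.
Proof. by move=> h; rewrite -[LHS]mulr1. Qed.

Lemma local_trunc3_regular2 : local_alg (trunc3 (trunc3 k^o) : comAlgType k).
Proof. exact: (@tE_local k (thickS (thickS (thick0 k)))). Qed.

Lemma local_trunc3_regular3 : local_alg (trunc3 (trunc3 (trunc3 k^o)) : comAlgType k).
Proof. exact: (@tE_local k (thickS (thickS (thickS (thick0 k))))). Qed.

(** The parameters are squares of the generators of nested truncations, and their coefficients are
    peeled off one generator at a time, from the outside. *)
Lemma two_nilpotents : exists (E : comAlgType k) (e t : E),
  [/\ local_alg E, e ^+ 2 = 0, t ^+ 2 = 0 & forall a, e * t * a%:A = 0 -> a = 0].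
Proof.
exists (trunc3 (trunc3 k^o)), (gen3 ^+ 2), (cst3m (trunc3 k^o) (gen3 ^+ 2)); split.
- exact: local_trunc3_regular2.
- exact: sqgen_sq.
- by rewrite -(rmorphXn (cst3m (trunc3 k^o))) sqgen_sq rmorph0.
move=> a h; apply: alg_eq0.
move: h; rewrite -mulrA => /coef_sqgen /(_ (cst3_mul_alg _ _)).
by move=> /coef_sqgen /(_ (cst3_alg _ _)).
Qed.

(** The scalar [a] absorbs the terms of order e t free of q, so that the coefficient of e t q can be
    read off without determining them. *)
Lemma three_nilpotents : exists (E : comAlgType k) (e t q : E),
  [/\ local_alg E, e ^+ 2 = 0, t ^+ 2 = 0, q ^+ 2 = 0 &
      forall a b, e * t * (a%:A + q * b%:A) = 0 -> b = 0].
Proof.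
pose E1 := trunc3 k^o; pose E2 := trunc3 E1.
exists (trunc3 E2), (gen3 ^+ 2), (cst3m E2 (gen3 ^+ 2)), (cst3m E2 (cst3m E1 (gen3 ^+ 2))); split.
- exact: local_trunc3_regular3.
- exact: sqgen_sq.
- by rewrite -(rmorphXn (cst3m E2)) sqgen_sq rmorph0.
- by rewrite -(rmorphXn (cst3m E2)) -(rmorphXn (cst3m E1)) sqgen_sq !rmorph0.
move=> a b; rewrite -mulrA.
have -> : cst3m E2 (gen3 ^+ 2) * (a%:A + cst3m E2 (cst3m E1 (gen3 ^+ 2)) * b%:A) =
    cst3 (gen3 ^+ 2 * cst3 (a%:A + gen3 ^+ 2 * b%:A : E1)).
  rewrite (cst3_alg E2 a) (cst3_alg E2 b) (cst3_alg E1 a) (cst3_alg E1 b).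
  by rewrite -[RHS]/(cst3m E2 _) -[in RHS]/(cst3m E1 _) !(rmorphM, rmorphD).
move=> /coef_sqgen /(_ erefl) /coef_sqgen /(_ erefl) h.
have a0 : (a%:A : k^o) = 0.
  have := congr1 (@co0 _ _) h; rewrite co0D co0M expr2 co0M [co0 gen3]/(0) !mul0r addr0.
  by rewrite cst3_alg.
move: h; rewrite [a%:A]cst3_alg a0 [cst3 0]rmorph0 add0r.
by move=> /coef_sqgen /(_ (cst3_alg _ _)) /alg_eq0.
Qed.

Lemma square_and_cube_nilpotents : exists (E : comAlgType k) (e e' t : E),
  [/\ local_alg E, e ^+ 2 = 0, e' ^+ 2 = 0, t ^+ 3 = 0 &
      forall a, e * e' * t ^+ 2 * a%:A = 0 -> a = 0].
Proof.
pose E1 := trunc3 k^o; pose E2 := trunc3 E1.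
exists (trunc3 E2), (gen3 ^+ 2), (cst3m E2 (gen3 ^+ 2)), (cst3m E2 (cst3m E1 gen3)); split.
- exact: local_trunc3_regular3.
- exact: sqgen_sq.
- by rewrite -(rmorphXn (cst3m E2)) sqgen_sq rmorph0.
- by rewrite -(rmorphXn (cst3m E2)) -(rmorphXn (cst3m E1)) gen3_cube !rmorph0.
move=> a; rewrite -2!mulrA.
have -> : cst3m E2 (gen3 ^+ 2) * (cst3m E2 (cst3m E1 gen3) ^+ 2 * a%:A) =
    cst3 (gen3 ^+ 2 * cst3 (gen3 ^+ 2 * a%:A : E1)).
  rewrite (cst3_alg E2 a) (cst3_alg E1 a).
  by rewrite -[RHS]/(cst3m E2 _) -[in RHS]/(cst3m E1 _) !(rmorphM, rmorphXn).
move=> /coef_sqgen /(_ erefl) /coef_sqgen /(_ erefl).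
by move=> /coef_sqgen /(_ (cst3_alg _ _)) /alg_eq0.
Qed.

Lemma translation_formP i b : exists c1 X Y r01 r02 r11 r12,
  translation_form i b c1 X Y r01 r02 r11 r12.
Proof.
have [c0 [c1 [X [Y [r01 [r02 [r11 [r12 H]]]]]]]] := translation_normal_form Hpi Hf i b.
suff c00 : c0 = 0.
  exists c1, X, Y, r01, r02, r11, r12 => B t e v p w t3 e2 p2 wP.
  by have := H B t e v p w t3 e2 p2 wP; rewrite c00 scale0r mul0r add0r.
have Hbase (B : comAlgType k) (e : B) (s : base k 2 B) : e ^+ 2 = 0 -> proj1_sig s ^+ 2 = 0 ->
    proj1_sig (beta B (translation_aut i e) s) = proj1_sig s + e * (c0%:A * proj1_sig s).
  move=> e2 s2.
  have [w wP] : exists w : Wn k 2 B, is_pt w (proj1_sig s) (at_chart b 0 0 1).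
    by apply: is_pt_exists; [exact: (proj2_sig s)|rewrite admissible_at; exact: unimod_pt].
  have [ws _ _] := wP; rewrite -(act_pi _ ws).
  have [-> _ _] := H B _ e 0 0 w (proj2_sig s) e2 (expr0n _ 2) wP.
  by rewrite s2 mulr0 addr0.
have [cS HS] := constant_aut_base beta (doubling_inverse k).
have cS0 := base_scale_neq0 HS.
have [E [e [t [_ e2 t2 coef_et]]]] := two_nilpotents.
have t3 : t ^+ 3 = 0 by rewrite exprS t2 mulr0.
pose s : base k 2 E := exist _ t t3.
(* On the base the two sides give cS (t + e c0 t) = cS t + 2 e c0 cS t. *)
have E1 := congr1 (fun g => proj1_sig (beta E g s)) (doubling_translation i e).
rewrite /= !actM in E1.
have b1 := Hbase E e s e2 t2.
have b2 := HS E s t2.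
have b3 : proj1_sig (beta E (translation_aut i e) s) ^+ 2 = 0 by rewrite b1 /=; ring: t2.
have b4 : proj1_sig (beta E (constant_aut (doubling_inverse k) E) s) ^+ 2 = 0.
  by rewrite b2 /= exprMn t2 mulr0.
have e2' : (2 * e) ^+ 2 = 0 by rewrite exprMn e2 mulr0.
have := HS E _ b3; have := Hbase E (2 * e) _ e2' b4; rewrite -E1 => ->.
rewrite b1 b2 /= => E2; suff : cS * c0 = 0.
  by move/eqP; rewrite mulf_eq0 (negPf cS0) => /eqP.
apply: coef_et; rewrite algM.
transitivity (cS%:A * t + 2 * e * (c0%:A * (cS%:A * t)) - cS%:A * (t + e * (c0%:A * t))).
  by ring.
by rewrite E2 subrr.
Qed.
End Identities.

(** * Identities between the coefficient polynomials *)

Section Identities.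
Variables (k : numClosedFieldType).
Variable alpha : algebraic_action (Aut (F2 k)) (Wn k 2).
Variable beta : algebraic_action (Aut (F2 k)) (base k 2).
Hypothesis Hpi : pi_equivariant alpha beta.
Hypothesis Hf : f_equivariant (tautological_action (F2 k)) alpha.
Local Notation G := (Aut (F2 k)).
Local Notation wform := (translation_form alpha).

Lemma pev_alg (B : comAlgType k) (z : k) p : pev (z%:A : B) p = p.[z]%:A.
Proof.
elim/poly_ind: p => [|p c IH]; first by rewrite rmorph0 horner0 scale0r.
by rewrite rmorphD rmorphM /= IH pevX pevC hornerMXaddC algD algM.
Qed.

Lemma algB (B : comAlgType k) (a b : k) : (a - b)%:A = a%:A - b%:A :> B.
Proof. by rewrite scalerBl. Qed.

Lemma algMn (B : comAlgType k) (a : k) n : (a *+ n)%:A = a%:A *+ n :> B.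
Proof. by rewrite scalerMnl. Qed.

Lemma algX (B : comAlgType k) (a : k) n : (a ^+ n)%:A = a%:A ^+ n :> B.
Proof. by elim: n => [|n IH]; rewrite ?expr0 ?scale1r // !exprS algM IH. Qed.

Lemma pt_eq (B : comAlgType k) (locB : local_alg B) (w : Wn k 2 B) b t t' v v' p p' :
  is_pt w t (at_chart b v p 1) -> is_pt w t' (at_chart b v' p' 1) ->
  [/\ t = t', v = v' & p = p'].
Proof.
move=> h h'; have [-> ] := is_pt_inj locB h h'.
rewrite W_same_eq => -[-> [_ [l [l' [_ [-> e1]]]]]]; split=> //.
by rewrite -[LHS]mul1r e1 mulr1.
Qed.

Lemma pt_ex (B : comAlgType k) (t : B) b v p : t ^+ 3 = 0 ->
  exists w : Wn k 2 B, is_pt w t (at_chart b v p 1).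
Proof. by move=> t3; apply: is_pt_exists => //; rewrite admissible_at; exact: unimod_pt. Qed.

(** This is the coefficient of e t in the v-coordinate of [torus_translation]: the translation
    followed by the torus gives 2 X(z), the other order c X(2z). The correction [D] cancels, as its
    interaction with X carries a factor t^2 = 0. *)
Lemma torus_identity c1 X Y r01 r02 r11 r12 :
  wform false false c1 X Y r01 r02 r11 r12 ->
  exists c, forall z, c * X.[2 * z] = 2 * X.[z].
Proof.
move=> HW; have [c Hc] := constant_aut_base beta (torus_inverse k).
have [|D HD] :=
  @constant_aut_normal_form k alpha beta Hpi Hf _ _ (torus_inverse k) c 2 false false Hc.
  move=> A v x y; rewrite [2%:A]/(scal A 2) /= !rmorph0 !rmorph1.
  by move: (scal A 2) => d; congr F2_at; ring.
exists c => z; have [E [e [t [locE e2 t2 coef_et]]]] := two_nilpotents k.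
have t3 : t ^+ 3 = 0 by rewrite exprS t2 mulr0.
have z2 : (0 : E) ^+ 2 = 0 by rewrite expr0n.
have [w wP] := pt_ex false z%:A 0 t3.
have w1P := HW E t e z%:A 0 w t3 e2 z2 wP.
have [s w2P] := HD E t z%:A 0 w t2 z2 wP.
rewrite t2 !mulr0 !mul0r !addr0 !add0r !pev_alg in w1P.
have p12 : (e * (qform (false == false) z%:A + t * (r01.[z])%:A)) ^+ 2 = 0.
  by rewrite exprMn e2 mul0r.
have [s' w3P] := HD E _ _ _ _ t2 p12 w1P.
rewrite -actM torus_translation actM add0r pev_alg in w3P w2P.
have c2 : (c%:A * t) ^+ 2 = 0 by rewrite exprMn t2 mulr0.
have c3 : (c%:A * t) ^+ 3 = 0 by rewrite exprS c2 mulr0.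
have s2 : (t * s) ^+ 2 = 0 by rewrite exprMn t2 mul0r.
have w4P := HW E _ e _ _ _ c3 e2 s2 w2P.
have [_ E1 _] := pt_eq locE w3P w4P.
move: E1; rewrite c2 !mul0r !addr0 -algM.
have h2 : (e * (t * (X.[z])%:A)) ^+ 2 = 0 by rewrite exprMn e2 mul0r.
have h2' : (t * (D.[z])%:A) ^+ 2 = 0 by rewrite exprMn t2 mul0r.
rewrite (pev_taylor _ _ h2) (pev_taylor _ _ h2') !pev_alg => E1.
apply/eqP; rewrite -subr_eq0; apply/eqP; apply: coef_et.
move: E1; rewrite [(_ - _)%:A](algB E) !(algM E) => /eqP; rewrite -subr_eq0 => /eqP E1.
rewrite -[RHS]oppr0 -[in RHS]E1; ring: t2.
Qed.

(** The same comparison for the exchange, which leads from one chart to the other without changing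
    the value of the affine coordinate; hence both polynomials are taken at the same z. The constant
    is the scalar by which the exchange acts on t. *)
Lemma swap_identity c1 X Y r01 r02 r11 r12 c1' X' Y' r01' r02' r11' r12' :
  wform false false c1 X Y r01 r02 r11 r12 ->
  wform true true c1' X' Y' r01' r02' r11' r12' ->
  exists2 c, c != 0 & forall z, X.[z] = c * X'.[z].
Proof.
move=> HW HW'; have [c Hc] := constant_aut_base beta (swap_inverse k).
have [|D HD] :=
  @constant_aut_normal_form k alpha beta Hpi Hf _ _ (swap_inverse k) c 1 false true Hc.
  by move=> A v x y; rewrite scale1r /= !rmorph0 !rmorph1; congr F2_at; ring.
exists c => [|z]; first exact: base_scale_neq0 Hc.
have [E [e [t [locE e2 t2 coef_et]]]] := two_nilpotents k.
have t3 : t ^+ 3 = 0 by rewrite exprS t2 mulr0.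
have z2 : (0 : E) ^+ 2 = 0 by rewrite expr0n.
have [w wP] := pt_ex false z%:A 0 t3.
have w1P := HW E t e z%:A 0 w t3 e2 z2 wP.
have [s w2P] := HD E t z%:A 0 w t2 z2 wP.
rewrite t2 !mulr0 !mul0r !addr0 !add0r !pev_alg in w1P.
have p12 : (e * (qform (false == false) z%:A + t * (r01.[z])%:A)) ^+ 2 = 0.
  by rewrite exprMn e2 mul0r.
have [s' w3P] := HD E _ _ _ _ t2 p12 w1P.
rewrite -actM swap_translation actM add0r pev_alg in w3P w2P.
have c2 : (c%:A * t) ^+ 2 = 0 by rewrite exprMn t2 mulr0.
have c3 : (c%:A * t) ^+ 3 = 0 by rewrite exprS c2 mulr0.
have s2 : (t * s) ^+ 2 = 0 by rewrite exprMn t2 mul0r.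
have w4P := HW' E _ e _ _ _ c3 e2 s2 w2P.
have [_ E1 _] := pt_eq locE w3P w4P.
move: E1; rewrite c2 !mul0r !addr0 !scale1r !mul1r.
have h2 : (e * (t * (X.[z])%:A)) ^+ 2 = 0 by rewrite exprMn e2 mul0r.
have h2' : (t * (D.[z])%:A) ^+ 2 = 0 by rewrite exprMn t2 mul0r.
rewrite (pev_taylor _ _ h2) (pev_taylor _ _ h2') !pev_alg => E1.
apply/eqP; rewrite -subr_eq0; apply/eqP; apply: coef_et.
move: E1; rewrite [(_ - _)%:A](algB E) !(algM E) => /eqP; rewrite -subr_eq0 => /eqP E1.
rewrite -[RHS]E1; ring: t2.
Qed.

(* Comparison of the two charts, at a point near the section [x = 0]. *)
Lemma chart_identity c1 X Y r01 r02 r11 r12 c1' X' Y' r01' r02' r11' r12' :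
  wform true false c1 X Y r01 r02 r11 r12 ->
  wform true true c1' X' Y' r01' r02' r11' r12' ->
  forall z, z != 0 -> X.[z] = - (z ^+ 2 * X'.[z^-1]) /\
    z * r11.[z] = z * r11'.[z^-1] + 2 * X.[z] - 2 * z ^+ 2.
Proof.
move=> HW HW' z z0.
have [E [e [t [q [locE e2 t2 q2 coef_etq]]]]] := three_nilpotents k.
have t3 : t ^+ 3 = 0 by rewrite exprS t2 mulr0.
pose v : E := z%:A; pose v' : E := z^-1%:A.
have vv : v * v' = 1 by rewrite -algM mulfV // scale1r.
have p2 : (q * v ^+ 2) ^+ 2 = 0 by rewrite exprMn q2 mul0r.
(* For p = q v^2 the fibre coordinate in the other chart is q / (1 - t v q) = q + t v q^2 = q, so
   the t-term of the gluing is invisible at this point and shows only once the point is moved. *)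
have [w wP] := pt_ex false v (q * v ^+ 2) t3.
have wP' : is_pt w t (at_chart true v' q 1).
  apply: is_pt_same wP _; rewrite (W_same_neq t false); split=> //=.
  pose l := v' ^+ 2 * (1 + t * v' * (q * v ^+ 2)).
  have lQ : l * (1 * v ^+ 2 - t * v * (q * v ^+ 2)) = 1.
    transitivity ((v * v') ^+ 2 - t * (v' ^+ 2 * q * v ^+ 3) * (1 - v * v')
      - t ^+ 2 * (v' ^+ 3 * v * q ^+ 2 * v ^+ 4)); first by rewrite /l; ring.
    by rewrite vv t2 subrr; ring.
  split; first by exists 0, l; rewrite mul0r add0r.
  exists l, (1 * v ^+ 2 - t * v * (q * v ^+ 2)); split=> //; split; last by rewrite lQ.
  transitivity (q * (v * v') ^+ 2 + q ^+ 2 * (t * v' ^+ 3 * v ^+ 4)); last by rewrite /l; ring.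
  by rewrite vv q2; ring.
have w1P := HW E t e v _ w t3 e2 p2 wP.
have w1P' := HW' E t e v' q w t3 e2 q2 wP'.
have [_] := is_pt_inj locE w1P w1P'.
rewrite t2 /= !mulr0 !mul0r !addr0 !pev_alg.
move=> /(W_same_neq _ false) [E1 [_ [l [l' [_ [E2 E3]]]]]].
move: E1 E2 E3; rewrite /sgn; set x := X.[z]%:A; set x' := X'.[_]%:A; set P := q * v ^+ 2 + _.
set P' := q + _; set Q := (1 * _ - _) => E1 E2 E3.
have {E2 E3} E4 : P = P' * Q by rewrite E2 mulrAC -E3 mul1r.
have XE : X.[z] = - (z ^+ 2 * X'.[z^-1]).
  have h : z^-1 * X.[z] + z * X'.[z^-1] = 0.
    apply: (coef_etq 0); rewrite scale0r add0r algD !algM -/x -/x' -/v -/v'.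
    transitivity (q * ((v + e * (t * x)) * (v' + e * (t * x')) - v * v')); first by ring: e2.
    by rewrite E1 vv subrr mulr0.
  have -> : X.[z] = z * (z^-1 * X.[z] + z * X'.[z^-1]) - z ^+ 2 * X'.[z^-1] by field.
  by rewrite h mulr0 add0r.
split=> //.
pose a := r01.[z] - r01'.[z^-1] * z ^+ 2.
(* To first order in t the gluing reads p' = p / v^2 + t p^2 / v^3. Moving p by e v^2 changes the
   last term by 2 e t p / v, which is the source of the term 2 z^2 and thereby of the constant 1 in
   the relation between X1 and X2. *)
have h : z ^+ 2 * r11.[z] - z * X.[z] *+ 2 + z ^+ 3 *+ 2 - z ^+ 2 * r11'.[z^-1] = 0.
  apply: (coef_etq a).
  have -> : a%:A = r01.[z]%:A - r01'.[z^-1]%:A * v ^+ 2 :> E.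
    by rewrite algB !(algX, algM).
  have -> : (z ^+ 2 * r11.[z] - z * X.[z] *+ 2 + z ^+ 3 *+ 2 - z ^+ 2 * r11'.[z^-1])%:A =
    v ^+ 2 * r11.[z]%:A - v * x *+ 2 + v ^+ 3 *+ 2 - v ^+ 2 * r11'.[z^-1]%:A :> E.
    by rewrite algB algD algB !algMn !(algX, algM).
  transitivity (P - P' * Q); first by rewrite /Q /P' /P; ring: e2 t2 q2.
  by rewrite E4 subrr.
apply: (mulfI z0); apply/eqP; rewrite -subr_eq0; apply/eqP; rewrite -[RHS]h; ring.
Qed.

(** The translations are composed in both orders, starting from p = 0. In the v-coordinate the
    coefficient of e e' t^2 yields the bracket of X1 and X2, with c1 and c2 coming from the motion
    of t. In the fibre coordinate the coefficient of e e' t combines the p-linear parts with the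
    derivative of v^2 along X1. *)
Lemma commutation_identity c1 X1 Y1 r1 s1 u1 m1 c2 X2 Y2 r2 s2 u2 m2 :
  wform false false c1 X1 Y1 r1 s1 u1 m1 ->
  wform true false c2 X2 Y2 r2 s2 u2 m2 ->
  forall z, c2 * X1.[z] + X1^`().[z] * X2.[z] = c1 * X2.[z] + X2^`().[z] * X1.[z] /\
    z ^+ 2 * u1.[z] = 2 * z * X1.[z] + u2.[z].
Proof.
move=> H1 H2 z.
have [E [e [e' [t [locE e2 e'2 t3 coef]]]]] := square_and_cube_nilpotents k.
pose v : E := z%:A.
have z2 : (0 : E) ^+ 2 = 0 by rewrite expr0n.
have [w wP] := pt_ex false v 0 t3.
have := H1 E t e v 0 w t3 e2 z2 wP; have := H2 E t e' v 0 w t3 e'2 z2 wP.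
rewrite /= !mul0r !addr0 !add0r !pev_alg.
set A1 := X1.[z]%:A; set A2 := X2.[z]%:A; set B1 := Y1.[z]%:A; set B2 := Y2.[z]%:A.
set R1 := r1.[z]%:A; set R2 := r2.[z]%:A; set S1 := s1.[z]%:A; set S2 := s2.[z]%:A.
set h1 := e * (t * A1 + _); set h2 := e' * (t * A2 + _).
set T1 := t + e * _; set T2 := t + e' * _.
set P1 := e * _; set P2 := e' * _ => w2P w1P.
have h12 : h1 ^+ 2 = 0 by rewrite /h1 exprMn e2 mul0r.
have h22 : h2 ^+ 2 = 0 by rewrite /h2 exprMn e'2 mul0r.
have P12 : P1 ^+ 2 = 0 by rewrite /P1 exprMn e2 mul0r.
have P22 : P2 ^+ 2 = 0 by rewrite /P2 exprMn e'2 mul0r.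
have T13 : T1 ^+ 3 = 0 by rewrite /T1; ring: e2 t3.
have T23 : T2 ^+ 3 = 0 by rewrite /T2; ring: e'2 t3.
have := H1 E T2 e (v + h2) P2 _ T23 e2 P22 w2P.
have := H2 E T1 e' (v + h1) P1 _ T13 e'2 P12 w1P.
rewrite -!actM translation_autC => w21 w12; have [_ EV EP] := pt_eq locE w12 w21.
move: EV EP; rewrite /qform /= !(pev_taylor _ _ h22) !(pev_taylor _ _ h12) !pev_alg.
rewrite -/A1 -/A2 -/B1 -/B2 -/R1 -/R2 -/S1 -/S2.
set U1 := u1.[z]%:A; set U2 := u2.[z]%:A; set D1 := X1^`().[z]%:A; set D2 := X2^`().[z]%:A.
move=> /eqP; rewrite -subr_eq0 => /eqP EV /eqP; rewrite -subr_eq0 => /eqP EP.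
split; apply/eqP; rewrite -subr_eq0; apply/eqP; apply: coef.
  have -> : (c2 * X1.[z] + X1^`().[z] * X2.[z] - (c1 * X2.[z] + X2^`().[z] * X1.[z]))%:A =
    c2%:A * A1 + D1 * A2 - (c1%:A * A2 + D2 * A1) by rewrite algB 2!algD !algM.
  rewrite -[RHS]EV /T1 /T2 /h1 /h2; ring: e2 e'2 t3.
have -> : (z ^+ 2 * u1.[z] - (2 * z * X1.[z] + u2.[z]))%:A = v ^+ 2 * U1 - (v * A1 *+ 2 + U2).
  by rewrite -mulrA mulr_natl algB algD algMn !(algX, algM).
(* The identity in the fibre coordinate is of order e e' t; a factor t brings it to the order that
   [coef] detects. *)
rewrite -[RHS](mulr0 t) -[in RHS]EP /T1 /T2 /P1 /P2 /h1 /h2; ring: e2 e'2 t3.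
Qed.
End Identities.

(** * Deriving the contradiction from the identities *)

Lemma poly_ext (k : numClosedFieldType) (p q : {poly k}) : (forall z, p.[z] = q.[z]) -> p = q.
Proof.
move=> H; apply/eqP; rewrite -subr_eq0; apply/eqP; apply: poly_eq0_everywhere => z.
by rewrite hornerD hornerN H subrr.
Qed.

(** The coefficients satisfy c 2^j a_j = 2 a_j. The nonzero constant term gives c = 2, and then
    2^(j+1) = 2 leaves only j = 0. *)
Lemma dilation_eigen (k : numClosedFieldType) (p : {poly k}) (c : k) :
  (forall z, c * p.[2 * z] = 2 * p.[z]) -> p`_0 != 0 -> p = (p`_0)%:P.
Proof.
move=> H a0.
have E j : c * 2 ^+ j * p`_j = 2 * p`_j.
  have [jp|] := ltnP j (size p); last by move/(nth_default 0) => ->; rewrite !mulr0.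
  have : \poly_(i < size p) (c * 2 ^+ i * p`_i) = \poly_(i < size p) (2 * p`_i).
    apply: poly_ext => z; rewrite !horner_poly.
    transitivity (c * p.[2 * z]).
      by rewrite horner_coef mulr_sumr; apply: eq_bigr => i _; rewrite exprMn; ring.
    by rewrite H horner_coef mulr_sumr; apply: eq_bigr => i _; rewrite mulrA.
  by move=> /(congr1 (fun q : {poly k} => q`_j)); rewrite /= !coef_poly jp.
have c2 : c = 2 by have := E 0%N; rewrite expr0 mulr1 => /(mulIf a0).
apply/polyP => -[|j]; rewrite coefC //=.
have := E j.+1; rewrite c2 -exprS => /eqP; rewrite -subr_eq0 -mulrBl mulf_eq0 => /orP[|/eqP //].
by rewrite subr_eq0 -natrX eqr_nat -[X in _ == X]expn1 eqn_exp2l.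
Qed.

Lemma no_action (k : numClosedFieldType)
    (alpha : algebraic_action (Aut (F2 k)) (Wn k 2))
    (beta : algebraic_action (Aut (F2 k)) (base k 2)) :
  pi_equivariant alpha beta ->
  ~ f_equivariant (tautological_action (F2 k)) alpha.
Proof.
move=> Hpi Hf.
have [c1 [X1 [Y1 [r1 [s1 [u1 [m1 H1]]]]]]] := translation_formP Hpi Hf false false.
have [c2 [X2 [Y2 [r2 [s2 [u2 [m2 H2]]]]]]] := translation_formP Hpi Hf true false.
have [c3 [X3 [Y3 [r3 [s3 [u3 [m3 H3]]]]]]] := translation_formP Hpi Hf true true.
have [c torus] := torus_identity Hpi Hf H1.
have [chi chi0 swap] := swap_identity Hpi Hf H1 H3.
have chart := chart_identity H2 H3.
have comm := commutation_identity H1 H2.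
have two0 := two_neq0 k.
have X1E : X1 = chi *: X3 by apply: poly_ext => z; rewrite hornerZ swap.
(* Both chart expressions are polynomial, as for a vector field on the projective line, so the chart
   formula reverses coefficients within degree 2. *)
have X2_coef j : X2`_j = if (j <= 2)%N then - X3`_(2 - j) else 0.
  rewrite (@poly_reverse k X2 (- X3) 2) ?coefN // => z z0.
  by have [-> _] := chart z z0; rewrite hornerN mulrN.
have u2_coef : u2`_1 = - (2 * X1`_0).
  have /(congr1 (fun p : {poly k} => p`_1)) : 'X^2 * u1 = 2 *: ('X * X1) + u2.
    apply: poly_ext => z; have [_ E] := comm z.
    by rewrite hornerD hornerZ (hornerM _ u1) hornerXn hornerM hornerX E mulrA.
  rewrite /= coefXnM coefD coefZ coefXM /= => /eqP; rewrite eq_sym addrC addr_eq0 => /eqP //.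
(* The chart identity writes z u2 - 2 X2 + 2 z^2 as z u3(1/z), which has no term of degree 2.
   Together with [u2_coef] this gives a + b = 1. *)
have coef_eq : u2`_1 = 2 * X2`_2 - 2.
  have := @poly_reverse k ('X * u2 - 2 *: X2 + 2 *: 'X^2) u3 1 _ 2.
  rewrite !(coefD, coefN, coefZ, coefXM, coefXn) /= => E.
  have {}E : u2`_1 - 2 * X2`_2 + 2 * 1 = 0.
    apply: E => z z0; have [_ e] := chart z z0.
    rewrite !(hornerD, hornerN, hornerZ, hornerM, hornerX, hornerXn) e expr1; ring.
  by apply/eqP; rewrite -subr_eq0; apply/eqP; rewrite -[RHS]E; ring.
have X1_0 : X1`_0 = chi * X3`_0 by rewrite X1E coefZ.
have X2_2 : X2`_2 = - X3`_0 by rewrite X2_coef.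
have a0 : X1`_0 != 0.
  apply/eqP => a0; move: coef_eq; rewrite u2_coef X2_2 a0.
  have -> : X3`_0 = 0 by apply: (mulfI chi0); rewrite -X1_0 a0 mulr0.
  by rewrite mulr0 !oppr0 mulr0 sub0r => /eqP; rewrite eq_sym oppr_eq0 (negPf two0).
have X1C := dilation_eigen torus a0.
have X2_1 : X2`_1 = 0.
  rewrite X2_coef /=; have := congr1 (fun p : {poly k} => p`_1) X1C.
  by rewrite /= coefC /= X1E coefZ => /eqP; rewrite mulf_eq0 (negPf chi0) => /eqP ->; rewrite oppr0.
(* With X1 equal to the constant a, the bracket relation reads c2 a = c1 X2 + a X2'. Its coefficient
   of v is 0 = 2 a b, as X2 has no linear term. *)
have /(congr1 (fun p : {poly k} => p`_1)) : (c2 * X1`_0)%:P = c1 *: X2 + X1`_0 *: X2^`().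
  apply: poly_ext => z; have [E _] := comm z; move: E.
  rewrite X1C derivC !hornerC mul0r addr0 coefC /= => ->.
  by rewrite hornerD !hornerZ [_ * X1`_0]mulrC.
rewrite /= coefC coefD !coefZ coef_deriv X2_1 mulr0 add0r X2_2 => /esym/eqP.
rewrite mulf_eq0 (negPf a0) -mulr_natl mulf_eq0 (negPf two0) oppr_eq0 /= => /eqP h.
by move: a0; rewrite X1_0 h mulr0 eqxx.
Qed.

Theorem theorem4p1 (R : realType) :
  ~ exists (alpha : forall n : nat, algebraic_action (Aut (F2 R[i])) (Wn R[i] n))
      (beta : forall n : nat, algebraic_action (Aut (F2 R[i])) (base R[i] n)),
      (forall n : nat,
         pi_equivariant (alpha n) (beta n) /\
         f_equivariant (tautological_action (F2 R[i])) (alpha n)) /\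
      (forall n : nat,
         induces (alpha n.+1) (beta n.+1) (alpha n) (beta n)).
Proof.
move=> [alpha [beta [equivariant _]]]; have [Hpi Hf] := equivariant 2.
exact: (@no_action R[i] (alpha 2) (beta 2) Hpi Hf).
Qed.
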